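(* Let $K$ be a flag simplicial complex on the vertex set $[m]=\{1,\dots,m\}$ and let $\underline{G}=(G_1,\dots,G_m)$ be a sequence of discrete groups. Then any presentation of the group $\mathrm{Cart}(\underline{G},K)$ contains at least $$M^-(\underline{G},K):=\operatorname{rank}\bigoplus_{J\subset[m]}\widetilde H_1(K_J;\mathbb Z)^{\oplus n_J}$$ relations. Moreover, $\operatorname{def}\mathrm{Cart}(\underline{G},K)\ge M^-(\underline{G},K)-N(\underline{G},K)$, where $N(\underline{G},K)=\sum_{J\subset[m]}n_J\cdot\widetilde b_0(K_J)$.
   Context: A simplicial complex $K$ on $[m]$ is a collection of subsets of $[m]$ (faces), closed under taking subsets, containing $\varnothing$ and all singletons $\{i\}$, $i\in[m]$. It is flag if $I\in K$ whenever $I\subset[m]$ and $\{i,j\}\in K$ for all $i,j\in I$. For $J\subset[m]$, $K_J=\{I\in K: I\subset J\}$ is the full subcomplex; topological notions applied to $K_J$ refer to its geometric realization $|K_J|$ ($|K_\varnothing|=\varnothing$). The graph product is $\underline{G}^K=(G_1\ast\dots\ast G_m)/(g_ig_j=g_jg_i \text{ for all } i\ne j,\ \{i,j\}\in K,\ g_i\in G_i,\ g_j\in G_j)$, and $\mathrm{Cart}(\underline{G},K)$ is the kernel of the natural projection $\underline{G}^K\to G_1\times\dots\times G_m$. $n_J:=\prod_{j\in J}|G_j\setminus\{1_j\}|$, where $1_j$ is the identity of $G_j$ (and $n_\varnothing=1$). $\widetilde b_0(X)=\dim_{\mathbb Q}\widetilde H_0(X;\mathbb Q)$ (so $\widetilde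 b_0(\varnothing)=0$). The rank of a group $G$ is $\operatorname{rank}G=\inf|X|$ and its deficiency is $\operatorname{def}G=\inf(|R|-|X|)$, both infima being over all presentations $G=\langle X\mid R\rangle$. *)

(* Defs.v *)
From HB Require Import structures.
From mathcomp Require Import all_boot all_order all_algebra.
From mathcomp Require Import generic_quotient ring_quotient.
From mathcomp Require Import all_classical all_reals all_analysis.

Set Implicit Arguments.
Unset Strict Implicit.
Unset Printing Implicit Defensive.

Import Order.TTheory GRing.Theory Num.Theory.

Local Open Scope classical_set_scope.
Local Open Scope card_scope.
Local Open Scope quotient_scope.
Local Open Scope group_scope.

(* Free groups.  A letter [(x, true)] stands for x, [(x, false)] for x^-1. *)

Section FreeGroup.
Variable X : choiceType.

Definition word := seq (X * bool).

Inductive word_eq : word -> word -> Prop :=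
| word_eq_refl w : word_eq w w
| word_eq_sym v w : word_eq v w -> word_eq w v
| word_eq_trans u v w : word_eq u v -> word_eq v w -> word_eq u w
| word_eq_cancel u v x b : word_eq (u ++ [:: (x, b), (x, ~~ b) & v]) (u ++ v).

Definition word_eqb : rel word := fun v w => `[< word_eq v w >].

Lemma word_eqb_equiv : equiv_class_of word_eqb.
Proof.
split=> [v|v w|v u w]; first exact/asboolP/word_eq_refl.
  by apply/asboolP/asboolP; exact: word_eq_sym.
by move=> /asboolP uv /asboolP vw; apply/asboolP; exact: word_eq_trans uv vw.
Qed.

Canonical word_equiv_rel := EquivRelPack word_eqb_equiv.

Definition free_group := {eq_quot word_equiv_rel}.

HB.instance Definition _ := Choice.on free_group.

Definition winv (w : word) : word := rev [seq (l.1, ~~ l.2) | l <- w].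

Lemma word_eq_catr u v w : word_eq u v -> word_eq (u ++ w) (v ++ w).
Proof.
elim=> {u v} [v|u v _|u v t _ uv _ vt|u v x b]; first exact: word_eq_refl.
- exact: word_eq_sym.
- exact: word_eq_trans uv vt.
- by rewrite -!catA /=; exact: word_eq_cancel.
Qed.

Lemma word_eq_catl u v w : word_eq u v -> word_eq (w ++ u) (w ++ v).
Proof.
elim=> {u v} [v|u v _|u v t _ uv _ vt|u v x b]; first exact: word_eq_refl.
- exact: word_eq_sym.
- exact: word_eq_trans uv vt.
- by rewrite !catA; exact: word_eq_cancel.
Qed.

Lemma winvK : involutive winv.
Proof.
move=> w; rewrite /winv map_rev revK -map_comp map_id_in // => -[x b] _ /=.
by rewrite negbK.
Qed.

Lemma word_eq_winv u v : word_eq u v -> word_eq (winv u) (winv v).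
Proof.
elim=> {u v} [v|u v _|u v t _ uv _ vt|u v x b]; first exact: word_eq_refl.
- exact: word_eq_sym.
- exact: word_eq_trans uv vt.
- rewrite /winv !map_cat !rev_cat /= !rev_cons -!cats1 -!catA /=.
  by case: b; exact: word_eq_cancel.
Qed.

Lemma word_eq_mulV w : word_eq (w ++ winv w) [::].
Proof.
elim/last_ind: w => [|w [x b] IH]; first exact: word_eq_refl.
apply: word_eq_trans IH.
by rewrite /winv map_rcons rev_rcons -cats1 -catA; exact: word_eq_cancel.
Qed.

Lemma free_eqP (v w : word) :
  reflect (word_eq v w) (\pi_free_group v == \pi_free_group w).
Proof. by rewrite eqmodE /= /word_eqb; exact: asboolP. Qed.

Definition free_one : free_group := \pi_free_group [::].
Definition free_mul (a b : free_group) : free_group := \pi_free_group (repr a ++ repr b).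
Definition free_inv (a : free_group) : free_group := \pi_free_group (winv (repr a)).

Lemma free_mul_pi v w :
  free_mul (\pi_free_group v) (\pi w) = \pi_free_group (v ++ w).
Proof.
have rv : word_eq (repr (\pi_free_group v)) v by apply/free_eqP; rewrite reprK.
have rw : word_eq (repr (\pi_free_group w)) w by apply/free_eqP; rewrite reprK.
apply/eqP/free_eqP; apply: word_eq_trans (word_eq_catr _ rv) _.
exact: word_eq_catl.
Qed.

Lemma free_inv_pi v : free_inv (\pi v) = \pi_free_group (winv v).
Proof.
by apply/eqP/free_eqP/word_eq_winv/free_eqP; rewrite reprK.
Qed.

Lemma free_mulA : associative free_mul.
Proof.
elim/quotW=> u; elim/quotW=> v; elim/quotW=> w.
by rewrite (free_mul_pi v) (free_mul_pi u v) !free_mul_pi catA.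
Qed.

Lemma free_mul1g : left_id free_one free_mul.
Proof. by move=> a; rewrite /free_one -[a]reprK free_mul_pi. Qed.

Lemma free_mulg1 : right_id free_one free_mul.
Proof. by move=> a; rewrite /free_one -[a]reprK free_mul_pi cats0. Qed.

Lemma free_mulgV : right_inverse free_one free_inv free_mul.
Proof.
move=> a; rewrite -[a]reprK free_inv_pi free_mul_pi.
by apply/eqP/free_eqP; exact: word_eq_mulV.
Qed.

Lemma free_mulVg : left_inverse free_one free_inv free_mul.
Proof.
move=> a; rewrite -[a]reprK free_inv_pi free_mul_pi -{2}[repr a]winvK.
by apply/eqP/free_eqP; exact: word_eq_mulV.
Qed.

HB.instance Definition _ := isGroup.Build free_group
  free_mulA free_mul1g free_mulg1 free_mulVg free_mulgV.

Definition free_gen (x : X) : free_group := \pi_free_group [:: (x, true)].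

Section Lift.
Variables (H : groupType) (f : X -> H).

Definition word_eval (w : word) : H :=
  foldr (fun l h => (if l.2 then f l.1 else (f l.1)^-1) * h) 1 w.

Lemma word_eval_cat v w : word_eval (v ++ w) = word_eval v * word_eval w.
Proof. by elim: v => /= [|l v ->]; rewrite ?mul1g ?mulgA. Qed.

Lemma word_eval_eq v w : word_eq v w -> word_eval v = word_eval w.
Proof.
elim=> {v w} // [u v w _ -> _ -> //|u v x b].
rewrite !word_eval_cat /=; congr (_ * _).
by case: b => /=; rewrite ?mulKg ?mulVKg.
Qed.

Definition free_lift (a : free_group) : H := word_eval (repr a).

Lemma free_lift_pi w : free_lift (\pi w) = word_eval w.
Proof. by apply/word_eval_eq/free_eqP; rewrite reprK. Qed.

Lemma free_liftM : {morph free_lift : a b / a * b}.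
Proof.
move=> a b; rewrite -[a]reprK -[b]reprK [_ * _]free_mul_pi.
by rewrite !free_lift_pi word_eval_cat.
Qed.

Lemma free_lift_gen x : free_lift (free_gen x) = f x.
Proof. by rewrite free_lift_pi /= mulg1. Qed.

End Lift.
End FreeGroup.

Section QuotientByRelators.
Variables (G : groupType) (S : set G).

Definition normal_subgroup (N : set G) : Prop :=
  [/\ N 1, forall x y, N x -> N y -> N (x / y) & forall x y, N x -> N (x ^ y)].

Definition normal_closure : set G :=
  [set x | forall N, normal_subgroup N -> S `<=` N -> N x].

Lemma normal_closureP : normal_subgroup normal_closure.
Proof.
split=> [N [] //|x y Sx Sy N NN SN|x y Sx N NN SN]; case: (NN) => N1 ND NJ.
  by apply: ND; [exact: Sx|exact: Sy].
by apply: NJ; exact: Sx.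
Qed.

Lemma sub_normal_closure : S `<=` normal_closure.
Proof. by move=> x Sx N _; apply. Qed.

Definition coset_eqb : rel G := fun x y => `[< normal_closure (x / y) >].

Lemma coset_eqb_equiv : equiv_class_of coset_eqb.
Proof.
have [N1 ND NJ] := normal_closureP.
have NV x : normal_closure x -> normal_closure x^-1.
  by move=> Nx; rewrite -[x^-1]mul1g; exact: ND.
split=> [x|x y|y x z]; first by apply/asboolP; rewrite divgg.
  by apply/asboolP/asboolP => /NV; rewrite invgF.
move=> /asboolP xy /asboolP yz; apply/asboolP.
rewrite -(mulgVK y x) -mulgA; rewrite -[y / z]invgK; apply: ND => //.
exact: NV.
Qed.

Canonical coset_equiv_rel := EquivRelPack coset_eqb_equiv.

Definition quotient_group := {eq_quot coset_equiv_rel}.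

HB.instance Definition _ := Choice.on quotient_group.

Lemma quo_eqP (x y : G) :
  reflect (normal_closure (x / y))
          (\pi_quotient_group x == \pi_quotient_group y).
Proof. by rewrite eqmodE /= /coset_eqb; exact: asboolP. Qed.

Definition quo_one : quotient_group := \pi_quotient_group 1.
Definition quo_mul (a b : quotient_group) : quotient_group :=
  \pi_quotient_group (repr a * repr b).
Definition quo_inv (a : quotient_group) : quotient_group := \pi_quotient_group (repr a)^-1.

Lemma quo_mul_pi x y :
  quo_mul (\pi_quotient_group x) (\pi y) = \pi_quotient_group (x * y).
Proof.
have [N1 ND NJ] := normal_closureP.
apply/eqP/quo_eqP; rewrite invgM.
set x' := repr _; set y' := repr _.
have Nx : normal_closure (x' / x) by apply/quo_eqP; rewrite reprK.
have Ny : normal_closure (y / y').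
  by apply/quo_eqP; rewrite eq_sym reprK.
have -> : x' * y' * (y^-1 * x^-1) = x' / x / ((y / y') ^ x^-1).
  by rewrite conjgE invgK !invgM !invgK !mulgA mulgVK.
by apply: ND => //; exact: NJ.
Qed.

Lemma quo_inv_pi x : quo_inv (\pi x) = \pi_quotient_group x^-1.
Proof.
have [N1 ND NJ] := normal_closureP.
apply/eqP/quo_eqP; rewrite invgK; set x' := repr _.
have Nx : normal_closure (x / x').
  by apply/quo_eqP; rewrite eq_sym reprK.
by have := NJ _ x' Nx; rewrite conjgE mulgVK.
Qed.

Lemma quo_mulA : associative quo_mul.
Proof.
elim/quotW=> u; elim/quotW=> v; elim/quotW=> w.
by rewrite (quo_mul_pi v) (quo_mul_pi u v) !quo_mul_pi mulgA.
Qed.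

Lemma quo_mul1g : left_id quo_one quo_mul.
Proof. by move=> a; rewrite /quo_one -[a]reprK quo_mul_pi mul1g. Qed.

Lemma quo_mulg1 : right_id quo_one quo_mul.
Proof. by move=> a; rewrite /quo_one -[a]reprK quo_mul_pi mulg1. Qed.

Lemma quo_mulVg : left_inverse quo_one quo_inv quo_mul.
Proof. by move=> a; rewrite /quo_one -[a]reprK quo_inv_pi quo_mul_pi mulVg. Qed.

Lemma quo_mulgV : right_inverse quo_one quo_inv quo_mul.
Proof. by move=> a; rewrite /quo_one -[a]reprK quo_inv_pi quo_mul_pi mulgV. Qed.

HB.instance Definition _ := isGroup.Build quotient_group
  quo_mulA quo_mul1g quo_mulg1 quo_mulVg quo_mulgV.

Definition quo (x : G) : quotient_group := \pi_quotient_group x.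

Lemma quoM : {morph quo : x y / x * y}.
Proof. by move=> x y; rewrite /quo -quo_mul_pi. Qed.

Lemma quo_rel x : S x -> quo x = 1.
Proof.
move=> Sx; apply/eqP/quo_eqP; rewrite divg1; exact: sub_normal_closure.
Qed.

Section Lift.
Variables (H : groupType) (f : G -> H).
Hypotheses (fM : {morph f : x y / x * y}) (fS : forall x, S x -> f x = 1).

Definition quo_lift (a : quotient_group) : H := f (repr a).

Let f1 : f 1 = 1.
Proof. by apply: (mulgI (f 1)); rewrite -fM !mulg1. Qed.

Let fV x : f x^-1 = (f x)^-1.
Proof. by apply: (mulgI (f x)); rewrite -fM !mulgV. Qed.

Lemma quo_lift_pi x : quo_lift (quo x) = f x.
Proof.
have : normal_closure (repr (quo x) / x) by apply/quo_eqP; rewrite reprK.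
move/(_ [set y | f y = 1]) => /= fx.
apply: (mulIg (f x)^-1); rewrite /quo_lift mulgV -fV -fM.
apply: fx; last exact: fS.
split=> //= [y z|y z]; first by rewrite fM fV => -> ->; rewrite invg1 mulg1.
by move=> fy; rewrite conjgE !fM fV fy mul1g mulVg.
Qed.

Lemma quo_liftM : {morph quo_lift : a b / a * b}.
Proof.
move=> a b; rewrite -[a]reprK -[b]reprK [_ * _]quo_mul_pi.
by rewrite !quo_lift_pi fM.
Qed.

End Lift.
End QuotientByRelators.

Definition presented (X : choiceType) (R : set (free_group X)) : groupType :=
  quotient_group R.

(* Relators are elements of the free group and [rels] is a set, so equal relators
   are counted once. *)
Record presentation (G : groupType) := Presentation {
  gens : choiceType;
  rels : set (free_group gens);
  pres_map : presented rels -> G;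
  pres_mapM : {morph pres_map : x y / x * y};
  pres_map_bij : bijective pres_map }.

Arguments rels {G} p _.

Section RankDeficiency.
Variable R : realType.
Local Open Scope ereal_scope.

(* [counting A] is the number of elements of [A], and +oo if [A] is infinite. *)

Definition rank (G : groupType) : \bar R :=
  ereal_inf [set r | exists P : presentation G, r = counting [set: gens P]].

(* [a - b] in the scope [dE] is the usual difference with +oo - +oo = +oo.
   Hence presentations with infinitely many generators and relations, for which
   |R| - |X| makes no sense, do not contribute to the infimum. *)
Definition deficiency (G : groupType) : \bar R :=
  ereal_inf [set r | exists P : presentation G,
                       r = (counting (rels P) - counting [set: gens P])%dE].

End RankDeficiency.

(* rank G <= |A| as cardinal numbers.  Any nonempty class of cardinals has a
   least element, so this bound on an infimum means that it is reached.  For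
   infinite cardinals it is finer than [rank R G <= counting A]. *)
Definition card_rank_le (G : groupType) T (A : set T) : Prop :=
  exists P : presentation G, [set: gens P] #<= A.

Record scomplex m := SComplex {
  faces :> {set {set 'I_m}};
  face0 : finset.set0 \in faces;
  face1 : forall i, [set i]%SET \in faces;
  face_sub : forall I J : {set 'I_m}, J \in faces -> I \subset J -> I \in faces }.

Definition flag m (K : scomplex m) : Prop :=
  forall I : {set 'I_m},
    {in I &, forall i j, [set i; j]%SET \in K} -> I \in K.

Definition full_subcomplex m (K : scomplex m) (J : {set 'I_m}) :
  {set {set 'I_m}} := [set I in K | I \subset J]%SET.

Section GraphProduct.
Variables (m : nat) (G : 'I_m -> groupType).

(* The free product, as the free group on the disjoint union of the [G i]
   modulo the multiplication tables. *)
Definition free_product_rels : set (free_group {i : 'I_m & G i}) :=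
  [set r | exists i (a b : G i),
     r = free_gen (Tagged G a) * free_gen (Tagged G b)
         / free_gen (Tagged G (a * b))].

Definition free_product : groupType := presented free_product_rels.

Definition free_product_in i (a : G i) : free_product :=
  quo free_product_rels (free_gen (Tagged G a)).

Definition graph_product_rels (K : scomplex m) : set free_product :=
  [set r | exists i j (a : G i) (b : G j),
     [/\ i != j, [set i; j]%SET \in K
       & r = [~ free_product_in a, free_product_in b]]].

Definition graph_product (K : scomplex m) : groupType :=
  quotient_group (graph_product_rels K).

Definition prod_group := forall i, G i.

HB.instance Definition _ := Choice.on prod_group.

Definition prod_one : prod_group := fun=> 1.
Definition prod_mul (f g : prod_group) : prod_group := fun i => f i * g i.
Definition prod_inv (f : prod_group) : prod_group := fun i => (f i)^-1.

Lemma prod_mulA : associative prod_mul.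
Proof. by move=> f g h; apply: functional_extensionality_dep => i; exact: mulgA. Qed.
Lemma prod_mul1g : left_id prod_one prod_mul.
Proof. by move=> f; apply: functional_extensionality_dep => i; exact: mul1g. Qed.
Lemma prod_mulg1 : right_id prod_one prod_mul.
Proof. by move=> f; apply: functional_extensionality_dep => i; exact: mulg1. Qed.
Lemma prod_mulVg : left_inverse prod_one prod_inv prod_mul.
Proof. by move=> f; apply: functional_extensionality_dep => i; exact: mulVg. Qed.
Lemma prod_mulgV : right_inverse prod_one prod_inv prod_mul.
Proof. by move=> f; apply: functional_extensionality_dep => i; exact: mulgV. Qed.

HB.instance Definition _ := isGroup.Build prod_group
  prod_mulA prod_mul1g prod_mulg1 prod_mulVg prod_mulgV.

Definition prod_in i (a : G i) : prod_group := eqtype.dfwith prod_one a.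

Lemma prod_mulE (f g : prod_group) i : (f * g) i = f i * g i.
Proof. by []. Qed.

Definition free_product_proj : free_product -> prod_group :=
  quo_lift (free_lift (fun t : {i : 'I_m & G i} => prod_in (tagged t))).

(* The natural projection of the graph product onto the direct product: it maps
   the image of [a : G i] to [prod_in a], see [graph_product_proj_in]. *)
Definition graph_product_proj (K : scomplex m) :
  graph_product K -> prod_group := quo_lift free_product_proj.

Lemma prod_inM i : {morph @prod_in i : a b / a * b}.
Proof.
move=> a b; apply: functional_extensionality_dep => j.
rewrite prod_mulE /prod_in.
have [->|ij] := eqVneq j i; first by rewrite !dfwith_in.
by rewrite !dfwith_out 1?eq_sym // [RHS]mul1g.
Qed.

Lemma prod_in_comm i j (a : G i) (b : G j) :
  i != j -> prod_in a * prod_in b = prod_in b * prod_in a.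
Proof.
move=> ij; apply: functional_extensionality_dep => k.
rewrite !prod_mulE /prod_in.
have [ki|ki] := eqVneq k i.
  subst k; rewrite dfwith_in dfwith_out 1?eq_sym //.
  by rewrite [LHS]mulg1 [RHS]mul1g.
rewrite [eqtype.dfwith _ a k]dfwith_out 1?eq_sym //.
by rewrite [LHS]mul1g [RHS]mulg1.
Qed.

Let F := free_lift (fun t : {i : 'I_m & G i} => prod_in (tagged t)).

Let FM : {morph F : x y / x * y}. Proof. exact: free_liftM. Qed.

Let F_rel x : free_product_rels x -> F x = 1.
Proof.
move=> [i [a [b ->]]]; set c := free_gen (Tagged G (a * b)).
apply: (mulIg (F c)); rewrite -FM mulgVK mul1g FM.
by rewrite /F /c !free_lift_gen /= prod_inM.
Qed.

Lemma free_product_proj_in i (a : G i) :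
  free_product_proj (free_product_in a) = prod_in a.
Proof.
by rewrite /free_product_proj /free_product_in quo_lift_pi // free_lift_gen.
Qed.

Let PM : {morph free_product_proj : x y / x * y}.
Proof. exact: quo_liftM. Qed.

Let P_rel K x : graph_product_rels K x -> free_product_proj x = 1.
Proof.
move=> [i [j [a [b [ij _ ->]]]]].
set u := free_product_in a; set v := free_product_in b.
apply: (mulgI (free_product_proj (v * u))); rewrite -PM mulg1.
rewrite commgEl conjgE !mulgA mulgK mulgV mul1g PM /u /v.
by rewrite PM !free_product_proj_in prod_in_comm.
Qed.

Definition graph_product_in K i (a : G i) : graph_product K :=
  quo (graph_product_rels K) (free_product_in a).

Lemma graph_product_proj_in K i (a : G i) :
  graph_product_proj (graph_product_in K a) = prod_in a.
Proof.
rewrite /graph_product_proj quo_lift_pi ?free_product_proj_in //.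
exact: P_rel.
Qed.

Lemma graph_product_projM K : {morph @graph_product_proj K : x y / x * y}.
Proof. by apply: quo_liftM; [exact: PM|exact: P_rel]. Qed.

Definition in_cart K : pred (graph_product K) :=
  fun x => graph_product_proj x == 1.

Lemma in_cart_closed K : group_closed (@in_cart K).
Proof.
have p1 : graph_product_proj (1 : graph_product K) = 1.
  apply: (mulgI (graph_product_proj (1 : graph_product K))).
  by rewrite -graph_product_projM !mulg1.
split=> [|x y]; rewrite !inE /in_cart ?p1 // => x1 y1.
by have := graph_product_projM (x / y) y; rewrite mulgVK x1 y1 mulg1 => <-.
Qed.

Record Cart K := MkCart { cart_val : graph_product K; _ : in_cart cart_val }.

HB.instance Definition _ K := [isSub of Cart K for @cart_val K].
HB.instance Definition _ K := [Choice of Cart K by <:].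
HB.instance Definition _ K :=
  SubChoice_isSubGroup.Build (graph_product K) (@in_cart K) (Cart K)
    (in_cart_closed K).

End GraphProduct.

Section QuotientModule.
Local Open Scope ring_scope.
Variables (R : nzRingType) (V : lmodType R) (S : {pred V}).

Definition submod_pred of submod_closed S : {pred V} := S.

Hypothesis submodS : submod_closed S.

HB.instance Definition _ := GRing.isSubmodClosed.Build R V
  (submod_pred submodS) submodS.

Definition quotient_module := @Quotient.quot V (submod_pred submodS).

HB.instance Definition _ := GRing.Zmodule.on quotient_module.

Definition quo_scale (a : R) (x : quotient_module) : quotient_module :=
  \pi_quotient_module (a *: repr x).

Lemma quo_scale_pi a v :
  quo_scale a (\pi_quotient_module v) = \pi_quotient_module (a *: v).
Proof.
apply/eqP; rewrite -Quotient.idealrBE -scalerBr rpredZ //.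
by rewrite Quotient.idealrBE reprK.
Qed.

Lemma quo_addr_pi u v : \pi_quotient_module u + \pi_quotient_module v =
  \pi_quotient_module (u + v) :> quotient_module.
Proof. by rewrite [RHS]Quotient.pi_add. Qed.

Lemma quo_scaleA a b x : quo_scale a (quo_scale b x) = quo_scale (a * b) x.
Proof. 
elim/quotW: x => v.
by rewrite (quo_scale_pi b) (quo_scale_pi a) (quo_scale_pi (a * b)) scalerA.
 Qed.

Lemma quo_scale1 : left_id 1 quo_scale.
Proof. by elim/quotW=> v; rewrite quo_scale_pi scale1r. Qed.

Lemma quo_scaleDr : right_distributive quo_scale +%R.
Proof.
move=> a; elim/quotW=> u; elim/quotW=> v.
by rewrite quo_addr_pi !(quo_scale_pi a) quo_addr_pi scalerDr.
Qed.

Lemma quo_scaleDl x : {morph quo_scale^~ x : a b / a + b}.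
Proof.
move=> a b /=; elim/quotW: x => v.
by rewrite !quo_scale_pi quo_addr_pi scalerDl.
Qed.

HB.instance Definition _ := GRing.Zmodule_isLmodule.Build R quotient_module
  quo_scaleA quo_scale1 quo_scaleDr quo_scaleDl.

End QuotientModule.

Section Homology.
Local Open Scope ring_scope.
Variables (R : nzRingType) (m : nat).
Implicit Types (D : {set {set 'I_m}}) (k : nat).

(* The homology of the realization |D| is given by the simplicial chains of [D].
   The vertices of a face are taken in increasing order, the face [s] has
   dimension #|s| - 1, and the empty face gives the augmentation. *)
Definition chain := {ffun {set 'I_m} -> R^o}.

Definition chain_of (s : {set 'I_m}) : chain := [ffun t => (t == s)%:R].

Definition boundary (c : chain) : chain :=
  \sum_(s : {set 'I_m}) c s *:
    \sum_(v in s) (-1) ^+ #|[set u in s | (u < v)%N]%SET| *: chain_of (s :\ v)%SET.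

(* Chains of the complex [D] spanned by the faces with [k] vertices. *)
Definition in_chains D k : pred chain :=
  fun c => [forall s, (c s != 0) ==> (s \in D) && (#|s| == k)].

Definition in_cycles D k : pred chain :=
  fun c => in_chains D k c && (boundary c == 0).

Lemma boundary_is_linear : linear boundary.
Proof.
move=> a c d; rewrite /boundary scaler_sumr -big_split /=; apply: eq_bigr => s _.
by rewrite !ffunE scalerDl scalerA.
Qed.

HB.instance Definition _ :=
  GRing.isLinear.Build R chain chain *:%R boundary boundary_is_linear.

Lemma in_chains_closed D k : submod_closed (in_chains D k).
Proof.
split; first by apply/forallP => s; rewrite ffunE eqxx.
move=> a c d /forallP Dc /forallP Dd; apply/forallP => s; apply/implyP.
move: (Dc s) (Dd s); rewrite !ffunE; case: (_ && _); rewrite ?implybT //.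
by rewrite !implybF !negbK => /eqP-> /eqP->; rewrite scaler0 addr0 eqxx.
Qed.

Lemma in_cycles_closed D k : submod_closed (in_cycles D k).
Proof.
have [c0 cD] := in_chains_closed D k.
split=> [|a c d /andP[Dc /eqP c1] /andP[Dd /eqP d1]].
  by apply/andP; split; rewrite ?linear0.
by apply/andP; split; [exact: cD|rewrite boundary_is_linear c1 d1 scaler0 addr0].
Qed.

HB.instance Definition _ D k :=
  GRing.isSubmodClosed.Build R chain (in_cycles D k) (in_cycles_closed D k).

Record cycle D k := MkCycle { cycle_val : chain; _ : in_cycles D k cycle_val }.

HB.instance Definition _ D k := [isSub of cycle D k for @cycle_val D k].
HB.instance Definition _ D k := [Choice of cycle D k by <:].
HB.instance Definition _ D k := [SubChoice_isSubLmodule of cycle D k by <:].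

Definition in_boundaries D k : pred (cycle D k) :=
  fun z => `[< exists2 c, in_chains D k.+1 c & boundary c = val z >].

Lemma in_boundaries_closed D k : submod_closed (@in_boundaries D k).
Proof.
have [c0 cD] := in_chains_closed D k.+1.
split; first by apply/asboolP; exists 0; rewrite ?linear0.
move=> a y z /asboolP[c Dc cy] /asboolP[d Dd dz]; apply/asboolP.
by exists (a *: c + d); [exact: cD|rewrite boundary_is_linear cy dz linearP].
Qed.

(* The reduced homology in dimension [n], since n-dimensional faces have n + 1
   vertices.  The case n = -1 is not needed. *)
Definition reduced_homology n D : lmodType R :=
  quotient_module (in_boundaries_closed D n.+1).

End Homology.

Definition is_vdim (F : fieldType) (V : lmodType F) (d : nat) : Prop :=
  inhabited (Vector.axiom d V).

Section FiniteDimension.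
Local Open Scope ring_scope.
Variable F : fieldType.

Lemma submodule_vdim (U : vectType F) (V : lmodType F) (h : {linear V -> U}) :
  injective h -> exists d, is_vdim V d.
Proof.
move=> h_inj.
pose P d := `[< exists2 W : {vspace U}, \dim W = d &
                  forall w, w \in W -> exists v, h v = w >].
have P0 : exists d, P d.
  exists 0%N; apply/asboolP; exists 0%VS; first exact: dimv0.
  by move=> w; rewrite memv0 => /eqP->; exists 0; rewrite linear0.
have Pb d : P d -> (d <= \dim {:U})%N.
  by move=> /asboolP[W <- _]; exact/dimvS/subvf.
case: (ex_maxnP P0 Pb) => d /asboolP[W Wd Wh] dmax.
have hW v : h v \in W.
  apply/negPn/negP => hvW.
  have /dmax : P (\dim (W + <[h v]>)%VS).
    apply/asboolP; exists (W + <[h v]>)%VS => // w /memv_addP[w1 /Wh[v1 <-]].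
    by move=> [w2 /vlineP[a ->] ->]; exists (v1 + a *: v); rewrite linearD linearZ.
  rewrite leqNgt -Wd => /negP; apply; rewrite ltnNge; apply/negP => leW.
  have /eqP WE : W == (W + <[h v]>)%VS by rewrite eqEdim addvSl leW.
  by move: hvW; rewrite WE (subvP (addvSr _ _)) ?memv_line.
have [f flin [f' fK f'K]] := subvs_vect_iso W.
exists (\dim W); constructor; exists (fun v => f (vsproj W (h v))).
  by move=> a u v; rewrite !linearP flin.
have g0 (w : subvs_of W) : exists v, h v = vsval w by exact/Wh/subvsP.
have [g gh] := choice g0.
exists (fun r => g (f' r)) => [v|r].
  by apply: h_inj; rewrite gh fK vsprojK.
by rewrite gh vsvalK f'K.
Qed.

Lemma quotient_vdim n (V : lmodType F) (g : {linear 'rV[F]_n -> V}) :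
  (forall v, exists r, g r = v) -> exists d, is_vdim V d.
Proof.
move=> g_surj.
pose P d := `[< exists M : 'M[F]_(d, n), forall r, g (r *m M) = 0 -> r = 0 >].
have P0 : exists d, P d.
  by exists 0%N; apply/asboolP; exists 0 => r _; apply/rowP; case.
have Pb d : P d -> (d <= n)%N.
  move=> /asboolP[M Minj]; have /eqP <- : row_free M; last exact: rank_leq_col.
  by rewrite -kermx_eq0 -submx0; apply/rV_subP => r /sub_kermxP rM;
    rewrite (Minj r) ?sub0mx // rM linear0.
case: (ex_maxnP P0 Pb) => d /asboolP[M Minj] dmax.
have M_surj v : exists r, g (r *m M) = v.
  have [r0 <-] := g_surj v; apply: contrapT => r0M.
  suff /dmax : P (d + 1)%N by rewrite addn1 ltnn.
  apply/asboolP; exists (col_mx M r0) => r.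
  rewrite -[r]hsubmxK mul_row_col [rsubmx r]mx11_scalar mul_scalar_mx.
  set a := rsubmx r 0 0; rewrite linearD linearZ /=.
  have [->|a0 /eqP] := eqVneq a 0.
    by rewrite scale0r addr0 => /Minj ->; rewrite raddf0 row_mx0.
  rewrite addr_eq0 => /eqP ra; exfalso; apply: r0M.
  exists (- a^-1 *: lsubmx r).
  by rewrite -scalemxAl linearZ /= ra scaleNr scalerN opprK scalerA mulVf ?scale1r.
have [h hM] := choice M_surj.
have M_inj r s : g (r *m M) = g (s *m M) -> r = s.
  move=> rs; apply/eqP; rewrite -subr_eq0; apply/eqP/Minj.
  by rewrite mulmxBl linearB /= rs subrr.
exists d; constructor; exists h.
  by move=> a u v; apply: M_inj; rewrite hM mulmxDl -scalemxAl linearP /= !hM.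
by exists (fun r => g (r *m M)) => [v|r]; [exact: hM|apply: M_inj; exact: hM].
Qed.

Lemma reduced_homology_vdim m n (D : {set {set 'I_m}}) :
  exists d, is_vdim (reduced_homology F n D) d.
Proof.
pose emb : {linear cycle F D n.+1 -> chain F m} := val.
have [d [[f flin [g fg gf]]]] := submodule_vdim (val_inj : injective emb).
pose q (r : 'rV[F]_d) : reduced_homology F n D :=
  \pi_(quotient_module (in_boundaries_closed F D n.+1)) (g r).
have qlin : linear q.
  move=> a r s; rewrite /q.
  have -> : g (a *: r + s) = a *: g r + g s.
    by apply: (can_inj fg); rewrite flin !gf.
  by rewrite -quo_addr_pi -quo_scale_pi.
pose qL := GRing.isLinear.Build F _ _ *:%R q qlin.
pose Q : {linear 'rV[F]_d -> reduced_homology F n D} := HB.pack q qL.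
apply: (@quotient_vdim d _ Q); elim/quotW=> v; exists (f v).
by rewrite /= /q fg.
Qed.

End FiniteDimension.

Definition reduced_betti0 m (D : {set {set 'I_m}}) : nat :=
  xget 0%N (is_vdim (reduced_homology rat 0 D)).

Lemma reduced_betti0P m (D : {set {set 'I_m}}) :
  is_vdim (reduced_homology rat 0 D) (reduced_betti0 D).
Proof. exact: xgetPex (reduced_homology_vdim _ _ _). Qed.

Section DirectSum.
Local Open Scope ring_scope.
Variables (I : Type) (V : I -> zmodType).

Definition finitely_supported : pred (forall i, V i) :=
  fun f => `[< finite_set [set i | f i != 0] >].

Record direct_sum :=
  DirectSum { direct_sum_val : forall i, V i; _ : finitely_supported direct_sum_val }.

HB.instance Definition _ := [isSub for direct_sum_val].
HB.instance Definition _ := [Choice of direct_sum by <:].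

Lemma direct_sumP (f g : direct_sum) : (forall i, val f i = val g i) -> f = g.
Proof. by move=> fg; apply/val_inj/functional_extensionality_dep. Qed.

Lemma direct_sum_finite (f : direct_sum) : finite_set [set i | val f i != 0].
Proof. by have /asboolP := valP f. Qed.

Lemma finitely_supported0 : finitely_supported (fun=> 0).
Proof.
apply/asboolP; rewrite (_ : [set _ | _] = set0) //.
by apply/seteqP; split=> i //=; rewrite eqxx.
Qed.

Lemma finitely_supportedD (f g : direct_sum) :
  finitely_supported (fun i => val f i + val g i).
Proof.
apply/asboolP.
apply: (@sub_finite_set _ _ ([set i | val f i != 0] `|` [set i | val g i != 0])).
  move=> i /=; have [->|] := eqVneq (val f i) 0; last by left.
  by rewrite add0r; right.
by rewrite finite_setU; split; exact: direct_sum_finite.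
Qed.

Lemma finitely_supportedN (f : direct_sum) :
  finitely_supported (fun i => - val f i).
Proof.
apply/asboolP; apply: (@sub_finite_set _ _ [set i | val f i != 0]).
  by move=> i /=; rewrite oppr_eq0.
exact: direct_sum_finite.
Qed.

Definition ds_zero := DirectSum finitely_supported0.
Definition ds_add f g := DirectSum (finitely_supportedD f g).
Definition ds_opp f := DirectSum (finitely_supportedN f).

Lemma ds_addA : associative ds_add.
Proof. by move=> f g h; apply: direct_sumP => i; exact: addrA. Qed.
Lemma ds_addC : commutative ds_add.
Proof. by move=> f g; apply: direct_sumP => i; exact: addrC. Qed.
Lemma ds_add0 : left_id ds_zero ds_add.
Proof. by move=> f; apply: direct_sumP => i; exact: add0r. Qed.
Lemma ds_addN : left_inverse ds_zero ds_opp ds_add.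
Proof. by move=> f; apply: direct_sumP => i; exact: addNr. Qed.

HB.instance Definition _ :=
  GRing.isZmodule.Build direct_sum ds_addA ds_addC ds_add0 ds_addN.

End DirectSum.

(* An additive abelian group, written multiplicatively. *)
Definition additive_group (V : zmodType) : Type := V.

HB.instance Definition _ (V : zmodType) := Choice.on (additive_group V).
HB.instance Definition _ (V : zmodType) := isGroup.Build (additive_group V)
  (@addrA V) (@add0r V) (@addr0 V) (@addNr V) (@subrr V).

Section Bounds.
Variables (m : nat) (G : 'I_m -> groupType) (K : scomplex m).

(* The product over j in J of the sets G_j minus the identity: it indexes the
   [n_J] copies of the homology of [K_J]. *)
Definition nontrivial_tuples (J : {set 'I_m}) : Type :=
  forall j : {j : 'I_m | j \in J}, {g : G (val j) | g != 1}.

Definition M_module : zmodType :=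
  direct_sum (fun i : {J : {set 'I_m} & nontrivial_tuples J} =>
    reduced_homology int 1 (full_subcomplex K (tag i)) : zmodType).

Definition M_group : groupType := additive_group M_module.

Section Values.
Variable R : realType.
Local Open Scope ereal_scope.

Definition M_minus : \bar R := rank R M_group.

(* 0 * +oo = 0 in [\bar R]. *)
Definition n_ (J : {set 'I_m}) : \bar R :=
  \prod_(j in J) counting [set g : G j | g != 1%g].

Definition N_ : \bar R :=
  \sum_(J : {set 'I_m}) n_ J * (reduced_betti0 (full_subcomplex K J))%:R%:E.

End Values.
End Bounds.

(* Main.v *)
(* Let F -> Cart(G, K) be the free group of a presentation <X | R>, with kernel N.  By
   Hopf's formula the second homology is the image of the relators with trivial
   exponent sums, a quotient of a subgroup of the free abelian group Z^(R).  So it is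
   enough to map it onto the direct sum of the groups H_1(K_J), one for each J and each
   tuple t of nontrivial elements of the G_j, j in J, and to bound the first Betti
   number by N(G, K).

   The Cartesian subgroup is the fundamental group of a cube complex with vertex set
   the direct product of the G_i, whose squares are the pairs of moves in directions i
   and j with {i, j} in K.  For (J, t), with T the indicator function of the vertices
   that agree with t on J, the square with corners p, px, py, pxy has the flux
   (T(pxy) - T(px) - T(py) + T(p)) [ij] in C_1(K_J) / B_1(K_J).  These cochains identify
   the second homology of the cube complex with the direct sum.  For flag K the flux has
   a potential on the graph product, by induction on J: a closed cochain in the
   directions of the link of a vertex has a primitive, because the subgroup generated
   by a set of vertices is a retract of the graph product.  The flux is then a character
   of N, and an alternating product of squares over a cube realizes every class.

   A character of Cart(G, K) is in the same way a closed 1-cochain of the cube complex,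
   which Moebius inversion turns into locally constant functions on the complexes K_J.
   Finally a subgroup of Z^(R) has a triangular set of generators, and linear algebra
   over the rationals compares their number with |R|, |X| and the Betti number. *)

Require Import Defs.
From HB Require Import structures.
From mathcomp Require Import all_boot all_order all_algebra.
From mathcomp Require Import generic_quotient.
From mathcomp Require wochoice.
From mathcomp Require Import all_classical all_reals all_analysis.
From mathcomp Require Import zify.

Set Implicit Arguments.
Unset Strict Implicit.
Unset Printing Implicit Defensive.

Import Order.TTheory GRing.Theory Num.Theory.

Local Open Scope classical_set_scope.
Local Open Scope card_scope.
Local Open Scope quotient_scope.
Local Open Scope group_scope.

(** * Groups, presentations and graph products *)

Section GroupMorphisms.
Variables (G H : groupType) (f : G -> H).
Hypothesis fM : {morph f : x y / x * y}.

Lemma morph_one : f 1 = 1.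
Proof. by apply: (mulgI (f 1)); rewrite -fM !mulg1. Qed.

Lemma morph_inv x : f x^-1 = (f x)^-1.
Proof. by apply: (mulgI (f x)); rewrite -fM !mulgV morph_one. Qed.

End GroupMorphisms.

Section FreeGroups.
Variable X : choiceType.

Definition free_word (w : word X) : free_group X := \pi_(free_group X) w.

Lemma free_word_cat v w : free_word (v ++ w) = free_word v * free_word w.
Proof. by rewrite [RHS]free_mul_pi. Qed.

Lemma free_gen_inv (x : X) : (free_gen x)^-1 = free_word [:: (x, false)].
Proof. by rewrite [LHS]free_inv_pi. Qed.

Lemma free_ind (P : free_group X -> Prop) :
  P 1 -> (forall x g, P g -> P (free_gen x * g)) ->
  (forall x g, P g -> P ((free_gen x)^-1 * g)) -> forall g, P g.
Proof.
move=> P1 Pgen PgenV; elim/quotW; elim=> [//|[x b] w IH].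
rewrite -/(free_word _) -cat1s free_word_cat.
by case: b; [exact: Pgen|rewrite -free_gen_inv; exact: PgenV].
Qed.

Lemma free_morph_ext (H : groupType) (f g : free_group X -> H) :
  {morph f : x y / x * y} -> {morph g : x y / x * y} ->
  (forall x, f (free_gen x) = g (free_gen x)) -> f =1 g.
Proof.
move=> fM gM fg; elim/free_ind=> [|x w IH|x w IH].
- by rewrite !morph_one.
- by rewrite fM gM fg IH.
- by rewrite fM gM !morph_inv // fg IH.
Qed.

End FreeGroups.

Section NormalClosure.
Variables (G : groupType) (S : set G).

Lemma normal_closure_min (N : set G) :
  normal_subgroup N -> S `<=` N -> normal_closure S `<=` N.
Proof. by move=> NN SN x; exact. Qed.

Lemma quo_eq x y : quo S x = quo S y -> normal_closure S (x / y).
Proof. by move/eqP/quo_eqP. Qed.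

Lemma quo_eqV x y : normal_closure S (x / y) -> quo S x = quo S y.
Proof. by move=> Sxy; apply/eqP/quo_eqP. Qed.

Lemma quo1 : quo S 1 = 1.
Proof. by apply: morph_one; exact: quoM. Qed.

Lemma quo_eq1 x : (quo S x = 1) <-> normal_closure S x.
Proof.
split=> [|Sx]; first by rewrite -quo1 => /quo_eq; rewrite divg1.
by rewrite -quo1; apply: quo_eqV; rewrite divg1.
Qed.

Lemma quo_surj a : exists x, quo S x = a.
Proof. by exists (repr a); exact: reprK. Qed.

End NormalClosure.

Section NormalSubgroups.
Variables (G : groupType) (N : set G).
Hypothesis NN : normal_subgroup N.

Lemma normal_subgroup1 : N 1. Proof. by case: NN. Qed.
Lemma normal_subgroupV x : N x -> N x^-1.
Proof. by case: NN => N1 ND _ Nx; rewrite -[x^-1]mul1g; exact: ND. Qed.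
Lemma normal_subgroupM x y : N x -> N y -> N (x * y).
Proof.
by move=> Nx Ny; case: NN => _ ND _; rewrite -[y]invgK; apply/ND/normal_subgroupV.
Qed.
End NormalSubgroups.

Lemma normal_closure_id (G : groupType) (N : set G) :
  normal_subgroup N -> normal_closure N = N.
Proof.
by move=> NN; apply/seteqP; split; [exact: normal_closure_min|exact: sub_normal_closure].
Qed.

Section Presentations.
Variable G : groupType.

(** All words that evaluate to 1 serve as relators; only the generators matter for a bound on the
    rank. *)
Lemma presentation_of_gens (X : choiceType) (f : X -> G) :
  (forall g, exists w, free_lift f w = g) ->
  exists P : presentation G, gens P = X.
Proof.
move=> fs; pose R := [set w : free_group X | free_lift f w = 1].
have fM := @free_liftM X G f.
have fR x : R x -> free_lift f x = 1 by [].
pose q : presented R -> G := quo_lift (free_lift f).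
have qM : {morph q : x y / x * y} by exact: quo_liftM.
have qE w : q (quo R w) = free_lift f w by exact: quo_lift_pi.
have [h hE] := choice fs.
have qbij : bijective q.
  exists (fun g => quo R (h g)) => [a|g]; last by rewrite qE hE.
  have [w <-] := quo_surj a; apply: quo_eqV; apply: sub_normal_closure.
  by rewrite /R /= fM morph_inv // hE qE mulgV.
by exists (Presentation qM qbij).
Qed.

Variable P : presentation G.

Definition pres_proj (w : free_group (gens P)) : G := pres_map (quo (rels P) w).

Lemma pres_projM : {morph pres_proj : x y / x * y}.
Proof. by move=> x y; rewrite /pres_proj quoM (@pres_mapM _ P). Qed.

Lemma pres_proj_surj g : exists w, pres_proj w = g.
Proof.
have [h hK Kh] := @pres_map_bij _ P.
by have [w hw] := quo_surj (h g); exists w; rewrite /pres_proj hw Kh.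
Qed.

Lemma pres_proj_eq1 w : (pres_proj w = 1) <-> normal_closure (rels P) w.
Proof.
have qM := @pres_mapM _ P; have qI := bij_inj (@pres_map_bij _ P).
rewrite -quo_eq1 /pres_proj; split=> [w1|->]; last exact: (morph_one qM).
by apply: qI; rewrite w1 (morph_one qM).
Qed.

End Presentations.

Section GraphProductUniversal.
Variables (m : nat) (G : 'I_m -> groupType) (K : scomplex m).
Notation GP := (graph_product G K).

Lemma graph_product_inM i : {morph @graph_product_in m G K i : x y / x * y}.
Proof.
move=> x y; rewrite /graph_product_in -quoM; congr quo.
rewrite /free_product_in -quoM; symmetry; apply: quo_eqV.
by apply: sub_normal_closure; exists i, x, y.
Qed.

Lemma graph_product_in1 i : graph_product_in K (1 : G i) = 1.
Proof. exact/morph_one/graph_product_inM. Qed.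

Lemma graph_product_inV i (x : G i) : graph_product_in K x^-1 = (graph_product_in K x)^-1.
Proof. exact/morph_inv/graph_product_inM. Qed.

Lemma graph_product_in_comm i j (x : G i) (y : G j) :
  i != j -> [set i; j]%SET \in faces K ->
  graph_product_in K x * graph_product_in K y =
  graph_product_in K y * graph_product_in K x.
Proof.
move=> ij ijK; rewrite /graph_product_in.
set u := free_product_in x; set v := free_product_in y.
rewrite -2!(@quoM _ (graph_product_rels K)).
have : quo (graph_product_rels K) [~ u, v] = 1.
  by apply: quo_rel; exists i, j, x, y.
rewrite commgEl conjgE => /(congr1 (fun z => quo (graph_product_rels K) (v * u) * z)).
by rewrite /= -quoM !mulgA mulgK mulgV mul1g mulg1.
Qed.

(** The inverse of a letter of [G i] is again a letter of [G i], so the induction has no case for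
    inverses. *)
Lemma graph_product_ind (P : GP -> Prop) :
  P 1 -> (forall g i (x : G i), P g -> P (graph_product_in K x * g)) -> forall g, P g.
Proof.
move=> P1 PM g; have [u <-] := quo_surj g; have [w <-] := quo_surj u.
elim/free_ind: w => [|[i x] w IH|[i x] w IH]; first by rewrite !quo1.
  by rewrite !quoM; exact: PM IH.
rewrite !quoM (morph_inv (quoM _)) (morph_inv (quoM _)).
by rewrite -[_^-1](graph_product_inV x); exact: PM IH.
Qed.

Lemma graph_product_ext (H : groupType) (f g : GP -> H) :
  {morph f : x y / x * y} -> {morph g : x y / x * y} ->
  (forall i (x : G i), f (graph_product_in K x) = g (graph_product_in K x)) -> f =1 g.
Proof.
move=> fM gM fg; elim/graph_product_ind=> [|u i x IH]; first by rewrite !morph_one.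
by rewrite fM gM fg IH.
Qed.

(** This universal property hides the two nested quotients from the later constructions of
    morphisms. *)
Lemma graph_product_lift (H : groupType) (f : forall i, G i -> H) :
  (forall i, {morph f i : x y / x * y}) ->
  (forall i j (x : G i) (y : G j), i != j -> [set i; j]%SET \in faces K ->
     f i x * f j y = f j y * f i x) ->
  exists2 F : GP -> H, {morph F : x y / x * y} &
    forall i (x : G i), F (graph_product_in K x) = f i x.
Proof.
move=> fM fC.
pose f0 := free_lift (fun t : {i : 'I_m & G i} => f (tag t) (tagged t)).
have f0M : {morph f0 : x y / x * y} by exact: free_liftM.
have f0R x : free_product_rels x -> f0 x = 1.
  by move=> [i [a [b ->]]]; rewrite !f0M morph_inv // /f0 !free_lift_gen /= fM mulgV.
pose f1 := quo_lift (S := @free_product_rels m G) f0.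
have f1M : {morph f1 : x y / x * y} by exact: quo_liftM.
have f1E i (x : G i) : f1 (free_product_in x) = f i x.
  by rewrite /f1 /free_product_in quo_lift_pi // /f0 free_lift_gen.
have f1R x : graph_product_rels K x -> f1 x = 1.
  move=> [i [j [a [b [ij ijK ->]]]]].
  rewrite commgEl conjgE !f1M !morph_inv // !f1E; apply: (mulgI (f j b * f i a)).
  by rewrite !mulgA mulgK mulgV mul1g mulg1 (fC i j).
exists (quo_lift (S := graph_product_rels K) f1); first exact: quo_liftM.
by move=> i x; rewrite /graph_product_in quo_lift_pi // f1E.
Qed.

End GraphProductUniversal.

(* The unrestricted wreath product of the right regular action of [G] by [A]. *)
Section Wreath.
Variables (G : groupType) (A : zmodType).

Definition wreath : Type := (G * (G -> A))%type.

HB.instance Definition _ := Choice.on wreath.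

Implicit Types h : wreath.
Definition wr_one : wreath := (1, fun=> 0%R).
Definition wr_mul h k : wreath := (h.1 * k.1, fun s => (h.2 s + k.2 (s * h.1)%g)%R).
Definition wr_inv h : wreath := (h.1^-1, fun s => (- h.2 (s * h.1^-1)%g)%R).

Lemma wr_mulA : associative wr_mul.
Proof.
move=> h k l; rewrite /wr_mul /= mulgA; congr (_, _).
by apply/funext => s; rewrite /= addrA mulgA.
Qed.
Lemma wr_mul1g : left_id wr_one wr_mul.
Proof.
by case=> g b; rewrite /wr_mul /= mul1g; congr (_, _); apply/funext => s; rewrite add0r mulg1.
Qed.
Lemma wr_mulg1 : right_id wr_one wr_mul.
Proof.
by case=> g b; rewrite /wr_mul /= mulg1; congr (_, _); apply/funext => s; rewrite addr0.
Qed.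
Lemma wr_mulVg : left_inverse wr_one wr_inv wr_mul.
Proof.
case=> g b; rewrite /wr_mul /= mulVg; congr (_, _); apply/funext => s /=.
by rewrite addNr.
Qed.
Lemma wr_mulgV : right_inverse wr_one wr_inv wr_mul.
Proof.
case=> g b; rewrite /wr_mul /= mulgV; congr (_, _); apply/funext => s /=.
by rewrite mulgK addrN.
Qed.

HB.instance Definition _ := isGroup.Build wreath
  wr_mulA wr_mul1g wr_mulg1 wr_mulVg wr_mulgV.

Lemma wr_fstM h k : (h * k).1 = h.1 * k.1. Proof. by []. Qed.
Lemma wr_sndM h k s : (h * k).2 s = (h.2 s + k.2 (s * h.1)%g)%R. Proof. by []. Qed.
Lemma wr_fstV h : (h^-1).1 = h.1^-1. Proof. by []. Qed.
Lemma wr_sndV h s : (h^-1).2 s = (- h.2 (s * h.1^-1)%g)%R. Proof. by []. Qed.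

End Wreath.

(** * Potentials on graph products *)

Section ZmodReflection.
Local Open Scope ring_scope.
Variable A : zmodType.

Inductive zmod_expr :=
  ZVar of nat | ZAdd of zmod_expr & zmod_expr | ZOpp of zmod_expr | ZZero.

Fixpoint zmod_eval (env : seq A) e : A :=
  match e with
  | ZVar n => nth 0 env n
  | ZAdd e1 e2 => zmod_eval env e1 + zmod_eval env e2
  | ZOpp e1 => - zmod_eval env e1
  | ZZero => 0
  end.

Fixpoint zmod_coef e (k : nat) : int :=
  match e with
  | ZVar n => (n == k)%:R
  | ZAdd e1 e2 => zmod_coef e1 k + zmod_coef e2 k
  | ZOpp e1 => - zmod_coef e1 k
  | ZZero => 0
  end.

Lemma zmod_evalE env e :
  zmod_eval env e = \sum_(k < size env) nth 0 env k *~ zmod_coef e k.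
Proof.
elim: e => [n|e1 IH1 e2 IH2|e IH|] /=.
- have [ns|sn] := ltnP n (size env).
    rewrite (bigD1 (Ordinal ns)) //= eqxx big1 ?addr0 // => k; rewrite -val_eqE /=.
    by rewrite eq_sym => /negPf->.
  rewrite nth_default // big1 // => k _.
  by rewrite (gtn_eqF (leq_trans (ltn_ord k) sn)).
- by rewrite IH1 IH2 -big_split; apply: eq_bigr => k _; rewrite mulrzDr.
- by rewrite IH -sumrN; apply: eq_bigr => k _; rewrite mulrNz.
- by rewrite big1 // => k _; rewrite mulr0z.
Qed.

Lemma zmod_eval_eq env e1 e2 :
  all (fun k => zmod_coef e1 k == zmod_coef e2 k) (iota 0 (size env)) ->
  zmod_eval env e1 = zmod_eval env e2.
Proof.
move=> /allP e12; rewrite !zmod_evalE; apply: eq_bigr => k _.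
by rewrite (eqP (e12 k _)) // mem_iota /=.
Qed.

End ZmodReflection.

(* Atoms are compared up to conversion, as the canonical structures inferred for
   the same operation may differ syntactically. *)
Ltac zmod_mem a l :=
  match l with
  | nil => constr:(false)
  | cons ?b ?l' =>
    match goal with
    | _ => let _ := match goal with _ => unify a b end in constr:(true)
    | _ => zmod_mem a l'
    end
  end.

Ltac zmod_index a l :=
  match l with
  | cons ?b ?l' =>
    match goal with
    | _ => let _ := match goal with _ => unify a b end in constr:(O)
    | _ => let n := zmod_index a l' in constr:(S n)
    end
  end.

Ltac zmod_atoms e l :=
  match e with
  | (?a + ?b)%R => let l' := zmod_atoms a l in zmod_atoms b l'
  | (- ?a)%R => zmod_atoms a l
  | 0%R => l
  | _ => match zmod_mem e l with true => l | false => constr:(cons e l) end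
  end.

Ltac zmod_reify e l :=
  match e with
  | (?a + ?b)%R => let a' := zmod_reify a l in let b' := zmod_reify b l in
      constr:(ZAdd a' b')
  | (- ?a)%R => let a' := zmod_reify a l in constr:(ZOpp a')
  | 0%R => constr:(ZZero)
  | _ => let n := zmod_index e l in constr:(ZVar n)
  end.

Ltac zmod_ring :=
  match goal with
  | |- @eq ?T ?a ?b =>
    let l0 := constr:(@nil T) in
    let l1 := zmod_atoms a l0 in let l := zmod_atoms b l1 in
    let a' := zmod_reify a l in let b' := zmod_reify b l in
    apply: (@zmod_eval_eq _ l a' b'); vm_compute; reflexivity
  end.

Ltac zmod_expand :=
  rewrite ?(mulrzDr, mulrNz, mulr0z, mulrzDl, mulNrz, mul0rz, mulrzA,
            addr0, add0r, subr0, oppr0).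

Section Potential.
Local Open Scope ring_scope.
Variables (m : nat) (G : 'I_m -> groupType) (K : scomplex m).
Notation GP := (graph_product G K).
Notation P := (prod_group G).
Notation "g :>> x" := (g * graph_product_in K x)%g (at level 40, left associativity).
Notation "p :-> x" := (p * prod_in x)%g (at level 40, left associativity).
Notation edge i j := ([set i; j]%SET \in faces K).
Implicit Types (J : {set 'I_m}) (t p : P) (g : GP).

Definition agree J t p : int := \prod_(k in J) (p k == t k)%:R.

(** The mixed second difference, over a square, of the indicator function of agreement with [t] on
    [J]. It vanishes unless both directions lie in [J]. *)
Definition agree2 J t p i j (x : G i) (y : G j) : int :=
  agree J t (p :-> x :-> y) - agree J t (p :-> x) - agree J t (p :-> y) + agree J t p.

Lemma prod_mul_in_out t p i (x : G i) k : k != i -> (p :-> x) k = p k.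
Proof. by move=> ki; rewrite prod_mulE /prod_in dfwith_out 1?eq_sym // [LHS]mulg1. Qed.

Lemma prod_mul_in p i (x : G i) : (p :-> x) i = (p i * x)%g.
Proof. by rewrite prod_mulE /prod_in dfwith_in. Qed.

Lemma agree_out J t p i (x : G i) : i \notin J -> agree J t (p :-> x) = agree J t p.
Proof.
move=> iJ; apply: eq_bigr => k kJ; rewrite prod_mul_in_out //.
by apply: contraNneq iJ => <-.
Qed.

Lemma agreeU1 J t p v : v \notin J ->
  agree (v |: J)%SET t p = agree [set v]%SET t p * agree J t p.
Proof. by move=> vJ; rewrite /agree big_setU1 // big_set1. Qed.

Lemma graph_product_projX g i (x : G i) :
  graph_product_proj (g :>> x) = graph_product_proj g :-> x.
Proof. by rewrite graph_product_projM graph_product_proj_in. Qed.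

(* [b] is a 1-cochain on the universal cover whose coboundary on the square spanned
   at [g] by [x] and [y] is [c i j], weighted by the corners of the square at
   which the direct product agrees with [t] on [J]. *)
Definition potential (A : zmodType) (c : 'I_m -> 'I_m -> A) J t
    (b : forall i, GP -> G i -> A) : Prop :=
  (forall i g (x y : G i), b i g (x * y)%g = b i g x + b i (g :>> x) y) /\
  (forall i j g (x : G i) (y : G j), i != j -> edge i j ->
     b i g x + b j (g :>> x) y - b j g y - b i (g :>> y) x =
     c i j *~ agree2 J t (graph_product_proj g) x y).

(** The commutations survive when the letters outside [L] are sent to 1. Functions composed with
    [rho] ignore the directions outside [L]. *)
Lemma retraction_exists (L : {set 'I_m}) : exists2 rho : GP -> GP,
  {morph rho : g h / (g * h)%g} &
  forall i (x : G i), rho (graph_product_in K x) = if i \in L then graph_product_in K x else 1%g.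
Proof.
apply: (graph_product_lift (H := GP)
  (f := fun i x => if i \in L then graph_product_in K x else 1%g)).
- by move=> i x y; case: ifP; rewrite ?mulg1 // graph_product_inM.
- move=> i j x y ij ijK; case: ifP => _; case: ifP => _; rewrite ?mulg1 ?mul1g //.
  exact: graph_product_in_comm.
Qed.

Section Primitive.
Variables (A : zmodType) (L : {set 'I_m}) (th : forall i, GP -> G i -> A).
Hypothesis thM : forall i g (x y : G i), i \in L ->
  th g (x * y)%g = th g x + th (g :>> x) y.
Hypothesis thC : forall i j g (x : G i) (y : G j), i \in L -> j \in L -> i != j ->
  edge i j -> th g x + th (g :>> x) y = th g y + th (g :>> y) x.

(* Loops of the graph product in the directions of [L] retract to words in the
   relations of [L], so a closed cochain on these directions has a primitive. *)
Lemma primitive_exists : exists B : GP -> A,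
  forall i g (x : G i), i \in L -> B (g :>> x) = B g + th g x.
Proof.
(* The second component of a letter records its increment of [th]; the relations hold in the wreath
   product because [th] is closed. *)
pose f i (x : G i) : wreath GP A :=
  if i \in L then ((graph_product_in K x, fun g => th g x) : wreath GP A) else 1%g.
have th1 i g : i \in L -> th g (1%g : G i) = 0.
  move=> iL; apply: (addrI (th g (1%g : G i))).
  by rewrite addr0 -{3}(mulg1 (1%g : G i)) thM // graph_product_in1 mulg1.
have [|i j x y ij ijK|Psi PsiM PsiE] := @graph_product_lift m G K (wreath GP A) f.
- move=> i x y; rewrite /f; case: ifP => iL; last by rewrite mulg1.
  apply: injective_projections; first by rewrite /= graph_product_inM.
  by apply/funext => g; rewrite /= thM.
- rewrite /f; case: ifP => iL; case: ifP => jL; rewrite ?mulg1 ?mul1g //.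
  apply: injective_projections; first by rewrite /= (graph_product_in_comm _ _ ij).
  by apply/funext => g; rewrite /= thC.
(* The increments are summed from the base point [g * (Psi g).1^-1], which does not move when a
   letter of [L] is appended to [g]. *)
exists (fun g => (Psi g).2 (g * (Psi g).1^-1)%g) => i g x iL.
rewrite PsiM PsiE /f iL wr_fstM wr_sndM /=; congr (_ + _).
  by rewrite invgM !mulgA mulgK.
by rewrite invgM !mulgA mulgK mulgVK.
Qed.

End Primitive.

(* Put [T] for the agreement on [J] and [tau] for the agreement at [v].  In the
   directions of [J] multiply the given potential by [tau]; in the direction of [v]
   take the increment of [tau] times a primitive [B] of
   [b i g x + c i v *~ (T (g x) - T g)], which is closed on the link of [v] because
   [c i j = c i v - c j v]. *)
Lemma potential_step (A : zmodType) (c : 'I_m -> 'I_m -> A) J t v :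
  v \notin J -> (forall i j, c j i = - c i j) ->
  (forall i j, i \in J -> j \in J -> i != j -> edge i j -> edge i v -> edge j v ->
     c i j = c i v - c j v) ->
  (exists b, potential c J t b) -> exists b, potential c (v |: J)%SET t b.
Proof.
move=> vJ cN cJ [b [bM bC]].
pose T g := agree J t (graph_product_proj g).
pose tau g := agree [set v]%SET t (graph_product_proj g).
pose L := [set i in J | edge i v]%SET.
pose th i g (x : G i) : A := b i g x + c i v *~ (T (g :>> x) - T g).
have [|i j g x y|B BE] := @primitive_exists A L th.
- move=> i g x y iL; rewrite /th bM graph_product_inM mulgA.
  by zmod_expand; zmod_ring.
- rewrite !inE => /andP[iJ iv] /andP[jJ jv] ij ijK.
  apply/eqP; rewrite -subr_eq0 /th; apply/eqP.
  have := bC i j g x y ij ijK; rewrite /agree2 -!graph_product_projX -!/(T _).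
  have -> : g :>> y :>> x = g :>> x :>> y.
    by rewrite -!mulgA (graph_product_in_comm _ _ ij).
  rewrite (cJ i j) //.
  rewrite !(mulrzDr, mulrNz, mulrzDl, mulNrz) => bE.
  apply: (etrans _ (subrr (b i g x + b j (g :>> x) y - b j g y - b i (g :>> y) x))).
  by rewrite {2}bE; zmod_ring.
(* Composition with the retraction onto [J] makes [b] and [B] blind to the steps outside [J],
   including those in the direction of [v]. *)
have [rho rhoM rhoE] := retraction_exists J.
pose b' i g (x : G i) : A := if i == v then B (rho g) *~ (tau (g :>> x) - tau g)
                     else if i \in J then b i (rho g) x *~ tau g else 0.
exists b'.
have rho_in i g (x : G i) : i \in J -> rho (g :>> x) = rho g :>> x.
  by move=> iJ; rewrite rhoM rhoE iJ.
have rho_out i g (x : G i) : i \notin J -> rho (g :>> x) = rho g.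
  by move=> iJ; rewrite rhoM rhoE (negPf iJ) mulg1.
have tau_out i g (x : G i) : i != v -> tau (g :>> x) = tau g.
  by move=> iv; rewrite /tau graph_product_projX agree_out // inE.
have T_rho g : T (rho g) = T g.
  rewrite /T; apply: eq_bigr => k kJ; congr ((_ == _)%:R); move: g.
  elim/graph_product_ind => [|g i x IH]; first by rewrite (morph_one rhoM).
  rewrite rhoM rhoE; case: ifP => iJ; rewrite !graph_product_projM !prod_mulE IH //.
  rewrite (morph_one (@graph_product_projM m G K)) graph_product_proj_in /prod_in dfwith_out //.
  by apply: contraFneq iJ => ->.
have TE g : agree (v |: J)%SET t (graph_product_proj g) = T g * tau g.
  by rewrite agreeU1 // mulrC.
have iv_J i : i \in J -> i != v by move=> iJ; apply: contraNneq vJ => <-.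
split=> [i g x y|].
  rewrite /b'.
  have [iv|iv] := eqVneq i v.
    rewrite rho_out ?iv // graph_product_inM mulgA; by zmod_expand; zmod_ring.
  have [iJ|iJ] := boolP (i \in J); last by rewrite addr0.
  by rewrite bM rho_in // tau_out // mulrzDl.
(* On a square with a side in direction [v], the increment of the primitive supplies the flux. The
   opposite order of the sides follows from the antisymmetry of [c]. *)
have b'C i g (x : G i) (y : G v) : i != v -> edge i v ->
    b' i g x + b' v (g :>> x) y - b' v g y - b' i (g :>> y) x =
    c i v *~ agree2 (v |: J)%SET t (graph_product_proj g) x y.
  move=> iv ivK; rewrite /agree2 -!graph_product_projX !TE /b' eqxx (negPf iv).
  have gC : g :>> x :>> y = g :>> y :>> x.
    by rewrite -!mulgA (graph_product_in_comm _ _ iv).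
  rewrite gC !(tau_out i) // (rho_out v) //.
  have Ty h : T (h :>> y) = T h by rewrite -T_rho rho_out // T_rho.
  case: ifP => iJ; last first.
    have Tx h : T (h :>> x) = T h by rewrite -T_rho rho_out ?iJ // T_rho.
    rewrite rho_out ?iJ // Tx Ty Tx.
    by zmod_expand; zmod_ring.
  rewrite rho_in // BE ?inE ?iJ // /th -(rho_in i) // !T_rho -gC Ty Ty.
  by zmod_expand; zmod_ring.
move=> i j g x y ij ijK.
have jiK : edge j i by rewrite finset.setUC.
have gC : g :>> x :>> y = g :>> y :>> x.
  by rewrite -!mulgA (graph_product_in_comm _ _ ij).
have [jv|jv] := eqVneq j v; first by subst j; exact: b'C.
have [iv|iv] := eqVneq i v.
  subst i; have := b'C j g y x jv jiK; rewrite /agree2 -!graph_product_projX gC.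
  rewrite (cN j v); zmod_expand.
  set a1 := c j v *~ _; set a2 := c j v *~ _; set a3 := c j v *~ _; set a4 := c j v *~ _.
  move/(congr1 -%R) => bE.
  apply: (etrans (y := - (b' j g y + b' v (g :>> y) x - b' v g x - b' j (g :>> x) y))).
    by zmod_ring.
  by rewrite bE; zmod_ring.
(* In the other directions [tau] is constant on the square and factors out of the law for [b]; with
   a side outside [J] both members vanish. *)
rewrite /agree2 -!graph_product_projX !TE gC !(tau_out i, tau_out j) // /b' (negPf iv) (negPf jv).
have T_out k h (z : G k) : k \notin J -> T (h :>> z) = T h.
  by move=> kJ; rewrite -T_rho rho_out // T_rho.
have [iJ|iJ] := boolP (i \in J); have [jJ|jJ] := boolP (j \in J).
- rewrite !(rho_in i, rho_in j) // !(tau_out i, tau_out j) //.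
  rewrite -!mulrzDl -!mulNrz -!mulrzDl bC // -mulrzA; congr (_ *~ _).
  rewrite /agree2 -!graph_product_projX -!(rho_in i, rho_in j) // -!/(T _) !T_rho gC.
  by rewrite !(mulrDl, mulNr).
- rewrite (rho_out j) // tau_out // -gC !(T_out j) //.
  by zmod_expand; zmod_ring.
- by rewrite (rho_out i) // tau_out // !(T_out i) //; zmod_expand; zmod_ring.
- by rewrite !(T_out i) //; zmod_expand; zmod_ring.
Qed.

(** Vertices are added to [J] one at a time, starting from the empty set, for which agreement is
    constant and the zero cochain works. *)
Lemma potential_exists (A : zmodType) (c : 'I_m -> 'I_m -> A) J t :
  (forall i j, c j i = - c i j) ->
  (forall i j k, i \in J -> j \in J -> k \in J -> i != j ->
     edge i j -> edge i k -> edge j k -> c i j = c i k - c j k) ->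
  exists b, potential c J t b.
Proof.
move=> cN; have [n] := ubnP #|J|; elim: n J => // n IH J Jn cJ.
have [->|[v vJ]] := set_0Vmem J.
  exists (fun i g x => 0); split=> [*|i j g x y _ _]; first by rewrite addr0.
  by rewrite /agree2 /agree !big_set0 (_ : 1 - 1 - 1 + 1 = 0 :> int) // mulr0z addr0 !subr0.
rewrite -(finset.setD1K vJ); apply: potential_step => //.
- by rewrite !inE eqxx.
- by move=> i j; rewrite !inE => /andP[_ iJ] /andP[_ jJ] ij ijK iv jv; exact: cJ.
- apply: IH => [|i j k]; first by move: Jn; rewrite (cardsD1 v J) vJ.
  by rewrite !inE => /andP[_ iJ] /andP[_ jJ] /andP[_ kJ]; exact: cJ.
Qed.

End Potential.

(** The edges of a square, closed up at its four corners, compose to a conjugate of the commutator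
    of its sides. *)
Lemma commutator_of_square (F : groupType) (a b c d x y : F) :
  (a * x * b^-1) * (b * y * c^-1) * (d * x * c^-1)^-1 * (a * y * d^-1)^-1 =
  a * (x * y * x^-1 * y^-1) * a^-1.
Proof. by rewrite !invgM !invgK !mulgA !mulgVK. Qed.

Lemma wr_square_val (F : groupType) (A : zmodType) (h1 h2 h3 h4 : wreath F A) s :
  ((h1 * h2 * h3^-1 * h4^-1)%g.2 s = h1.2 s + h2.2 (s * h1.1)%g -
    h3.2 (s * (h1.1 * h2.1 * h3.1^-1))%g - h4.2 (s * (h1.1 * h2.1 * h3.1^-1 * h4.1^-1))%g)%R.
Proof. by rewrite 3!wr_sndM 2!wr_sndV !wr_fstM !wr_fstV !mulgA. Qed.

(** * The flux through squares *)

Section Flux.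
Local Open Scope ring_scope.
Variables (m : nat) (G : 'I_m -> groupType) (K : scomplex m).
Notation GP := (graph_product G K).
Notation P := (prod_group G).
Notation "g :>> x" := (g * graph_product_in K x)%g (at level 40, left associativity).
Notation "p :-> x" := (p * prod_in x)%g (at level 40, left associativity).
Notation edge i j := ([set i; j]%SET \in faces K).
Notation pr := (@graph_product_proj m G K).

(* The functions on the relators that Hopf's formula pairs with the second homology. *)
Definition closure_char (F : groupType) (N : set F) (B : zmodType) (phi : F -> B) : Prop :=
  (forall u v, N u -> N v -> phi (u * v)%g = phi u + phi v) /\
  (forall u v, N u -> phi (v * u * v^-1)%g = phi u).

Definition square (F : groupType) (eps : P -> forall i, G i -> F)
    p i j (x : G i) (y : G j) : F :=
  (eps p i x * eps (p :-> x) j y * (eps (p :-> y) i x)^-1 * (eps p j y)^-1)%g.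

(* Read [J], [t] as an index of the direct sum: the value of [phi] on a square is its
   flux up to the coboundary of [eta], so it is the flux on cycles of squares. *)
Definition square_law (F : groupType) (eps : P -> forall i, G i -> F)
    (A : zmodType) (phi : F -> A) (c : 'I_m -> 'I_m -> A) J t
    (eta : P -> forall i, G i -> A) : Prop :=
  forall p i j (x : G i) (y : G j), i != j -> edge i j ->
    phi (square eps p x y) = c i j *~ agree2 J t p x y +
      (eta p i x + eta (p :-> x) j y - eta (p :-> y) i x - eta p j y).

Section Holonomy.
Variables (A : zmodType) (c : 'I_m -> 'I_m -> A) (J : {set 'I_m}) (t : P).
Variable b : forall i, GP -> G i -> A.
Hypothesis bP : potential c J t b.

Notation W := (wreath GP A).

(* The coboundary of a potential factors through the direct product, so a potential
   gives a morphism to the wreath product only modulo these functions. *)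
Definition proj_functions : set W :=
  [set h | h.1 = 1%g /\ exists f : P -> A, forall s, h.2 s = f (pr s)].

Lemma proj_functions_normal : normal_subgroup proj_functions.
Proof.
have prM := @graph_product_projM m G K.
split=> [|h k [h1 [f hf]] [k1 [f' kf]]|h k [h1 [f hf]]].
- by split=> //; exists (fun=> 0).
- split; first by rewrite wr_fstM wr_fstV h1 k1 divg1.
  exists (fun p => f p - f' p) => s.
  by rewrite wr_sndM wr_sndV h1 k1 invg1 !mulg1 hf kf.
- split; first by rewrite conjgE !wr_fstM wr_fstV h1 mul1g mulVg.
  exists (fun p => f (p * pr k.1^-1)%g) => s.
  rewrite conjgE !wr_sndM wr_sndV wr_fstV h1 ?mulg1.
  by rewrite hf prM; zmod_ring.
Qed.

(** The commutation relations hold in the quotient because the defect of [b] on a square depends on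
    the projection alone. The last clause holds because [proj_functions] lies over 1. *)
Lemma holonomy_exists : exists hol : GP -> quotient_group proj_functions,
  [/\ {morph hol : g h / (g * h)%g},
      forall i (x : G i), hol (graph_product_in K x) =
        quo proj_functions ((graph_product_in K x, fun s => b s x) : W)
    & forall g h, quo proj_functions h = hol g -> h.1 = g].
Proof.
have [bM bC] := bP; have SN := proj_functions_normal.
pose f i (x : G i) := quo proj_functions ((graph_product_in K x, fun s => b s x) : W).
have [i x y|i j x y ij ijK|hol holM holE] :=
    @graph_product_lift m G K (quotient_group proj_functions) f.
- rewrite /f -quoM; congr quo; apply: injective_projections => /=.
    by rewrite graph_product_inM.
  by apply/funext => s; rewrite /= bM.
- rewrite /f -!quoM; apply: quo_eqV; apply: sub_normal_closure; split.
    by rewrite wr_fstM wr_fstV !wr_fstM /= (graph_product_in_comm _ _ ij) // mulgV.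
  exists (fun p => c i j *~ agree2 J t p x y) => s.
  rewrite -bC // wr_sndM wr_sndV !wr_sndM !wr_fstM /= (graph_product_in_comm _ _ ij) //.
  by rewrite mulgK; zmod_ring.
exists hol; split=> // g h hg.
pose q := quo_lift (S := proj_functions) (fst : W -> GP).
have fS k : proj_functions k -> k.1 = 1%g by case.
have qM : {morph q : a a' / (a * a')%g} by exact: quo_liftM.
have qE k : q (quo proj_functions k) = k.1 by exact: quo_lift_pi.
rewrite -qE hg; apply: (graph_product_ext (f := q \o hol) (g := id)) => //.
  by move=> u v; rewrite /= holM qM.
by move=> i x; rewrite /= holE qE.
Qed.

(** [psi] reads at 1 the second component of a lift [u] of the holonomy to the free group. On words
    with trivial image this component factors through the direct product, and conjugation does not
    change it, since all values of [pi] project to 1. *)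
Lemma flux_char (X : choiceType) (pi : free_group X -> GP) :
  {morph pi : u v / (u * v)%g} -> (forall w, pr (pi w) = 1%g) ->
  exists2 psi : free_group X -> A, closure_char [set w | pi w = 1%g] psi &
  forall (s : P -> GP) (eps : P -> forall i, G i -> free_group X),
    (forall p, pr (s p) = p) ->
    (forall p i x, pi (eps p i x) = (s p :>> x * (s (p :-> x))^-1)%g) ->
    exists eta, square_law eps psi c J t eta.
Proof.
move=> piM pr_pi; have [bM bC] := bP; have SN := proj_functions_normal.
have [hol [holM holE hol_fst]] := holonomy_exists.
have [hat hatE] := choice (fun g => quo_surj (hol g)).
pose u := free_lift (fun x => hat (pi (free_gen x))).
have uM : {morph u : v w / (v * w)%g} by exact: free_liftM.
have uE w : quo proj_functions (u w) = hol (pi w).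
  apply: (free_morph_ext (f := quo proj_functions \o u) (g := hol \o pi)).
  - by move=> v v' /=; rewrite uM quoM.
  - by move=> v v' /=; rewrite piM holM.
  - by move=> x; rewrite /= /u free_lift_gen hatE.
have u_fst w : (u w).1 = pi w by exact: hol_fst.
have uN w : pi w = 1%g -> proj_functions (u w).
  move=> w1; rewrite -(normal_closure_id SN); apply/quo_eq1.
  by rewrite uE w1 (morph_one holM).
clearbody u.
exists (fun w => (u w).2 1%g).
  split=> [v w v1 w1|v w v1]; first by rewrite uM wr_sndM u_fst v1 mulg1.
  have [_ [f vf]] := uN _ v1.
  rewrite !uM (morph_inv uM) !wr_sndM wr_sndV !wr_fstM !u_fst v1 mulg1 mul1g mulgV !vf.
  by rewrite pr_pi (morph_one (@graph_product_projM _ _ _)); zmod_ring.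
move=> s eps prs epsE.
pose xh i (x : G i) : W := (graph_product_in K x, fun s => b s x).
(* [e] models an edge word by lifts of the holonomy at the section; the discrepancy [z] lies in
   [proj_functions], and its value is the correction [eta]. *)
pose e p i (x : G i) : W := (hat (s p) * xh i x * (hat (s (p :-> x)))^-1)%g.
pose z p i (x : G i) : W := (u (eps p i x) / e p i x)%g.
have zS p i x : proj_functions (z p i x).
  rewrite -(normal_closure_id SN); apply: quo_eq.
  rewrite uE epsE /e !quoM (morph_inv (quoM _)) !holM (morph_inv holM) !hatE.
  by rewrite -holE.
have zE p i x : u (eps p i x) = (z p i x * e p i x)%g by rewrite /z mulgVK.
pose eta p i x := (z p i x).2 1%g.
exists eta => p i j x y ij ijK.
(* The lifts at the corners telescope around the square. *)
have eE : square e p x y =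
    (hat (s p) * (xh i x * xh j y * (xh i x)^-1 * (xh j y)^-1) * (hat (s p))^-1)%g.
  have C : (p :-> y :-> x = p :-> x :-> y :> P)%g.
    by rewrite -mulgA -(prod_in_comm _ _ ij) mulgA.
  rewrite -(commutator_of_square (hat (s p)) (hat (s (p :-> x)))
    (hat (s (p :-> x :-> y))) (hat (s (p :-> y)))).
  by rewrite /square /e C.
clearbody e z.
(* All base points that occur lie over 1, and an element of [proj_functions] takes the same value at
   each of them. *)
have z1 q k (w : G k) r : pr r = 1%g -> (z q k w).2 r = eta q k w.
  have [_ [f zf]] := zS q k w.
  by rewrite /eta !zf => ->; rewrite (morph_one (@graph_product_projM _ _ _)).
have Eeps q k (w : G k) r : pr r = 1%g ->
    (u (eps q k w)).2 r = eta q k w + (e q k w).2 r.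
  by move=> r1; rewrite zE wr_sndM z1 //; have [-> _] := zS q k w; rewrite mulg1.
have e_fst q k (w : G k) : (e q k w).1 = pi (eps q k w).
  by rewrite -u_fst zE wr_fstM; have [-> _] := zS q k w; rewrite mul1g.
have prV r : (pr r^-1 = (pr r)^-1)%g by exact/morph_inv/graph_product_projM.
have pr1 : pr 1%g = 1%g by exact/morph_one/graph_product_projM.
have -> : (u (square eps p x y)).2 1%g = (square e p x y).2 1%g +
    (eta p i x + eta (p :-> x) j y - eta (p :-> y) i x - eta p j y).
  have uV w : u w^-1%g = (u w)^-1%g by exact: (morph_inv uM).
  rewrite /square 3!uM 2!uV 2!wr_square_val !e_fst !u_fst.
  have prM := @graph_product_projM m G K.
  rewrite !Eeps; first by zmod_ring.
  1-4: by rewrite ?prM ?prV ?pr_pi ?pr1 ?(mul1g, mulg1, invg1).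
congr (_ + _).
rewrite eE.
rewrite !wr_sndM !wr_sndV !wr_fstM !wr_fstV /=.
have -> : (hat (s p)).1 = s p by apply: hol_fst; rewrite hatE.
have gC : (graph_product_in K x * graph_product_in K y =
           graph_product_in K y * graph_product_in K x)%g.
  exact: graph_product_in_comm.
rewrite gC !mulgA mul1g mulgK mulgK.
rewrite -[in RHS](prs p) -bC //.
by rewrite mulgV; zmod_ring.
Qed.
End Holonomy.
End Flux.

(** * Words of cycles *)

Section ClosureCharacters.
Local Open Scope ring_scope.
Variables (F : groupType) (N : set F) (B : zmodType) (phi : F -> B).
Hypotheses (NN : normal_subgroup N) (phiP : closure_char N phi).

Lemma closure_char1 : phi 1%g = 0.
Proof.
have [phiM _] := phiP; have N1 := normal_subgroup1 NN.
by apply: (addrI (phi 1%g)); rewrite -phiM // mulg1 addr0.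
Qed.

Lemma closure_charV u : N u -> phi u^-1%g = - phi u.
Proof.
have [phiM _] := phiP; move=> Nu; apply: (addrI (phi u)).
by rewrite -phiM ?mulgV ?closure_char1 ?subrr //; exact: normal_subgroupV.
Qed.

Definition expz (u : F) (n : int) : F :=
  match n with Posz k => (u ^+ k)%g | Negz k => (u ^- k.+1)%g end.

Lemma closure_char_expz u n : N u -> N (expz u n) /\ phi (expz u n) = phi u *~ n.
Proof.
have [phiM _] := phiP; move=> Nu.
have H k : N (u ^+ k)%g /\ phi (u ^+ k)%g = phi u *+ k.
  elim: k => [|k [Nk IH]]; first by split; [exact: normal_subgroup1|exact: closure_char1].
  by rewrite expgS mulrS -IH -phiM //; split=> //; exact: normal_subgroupM.
case: n => k; first exact: H.
have [Nk kE] := H k.+1; split; first exact: normal_subgroupV.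
by rewrite [LHS]closure_charV // kE.
Qed.

Lemma closure_char_prod (I : eqType) (r : seq I) (w : I -> F) (v : I -> B) :
  (forall i, i \in r -> N (w i) /\ phi (w i) = v i) ->
  N (\prod_(i <- r) w i)%g /\ phi (\prod_(i <- r) w i)%g = \sum_(i <- r) v i.
Proof.
have [phiM _] := phiP; elim: r => [_|i r IH wv]; rewrite ?big_nil ?big_cons.
  by split; [exact: normal_subgroup1|exact: closure_char1].
have [Ni <-] := wv i (mem_head _ _).
have [|Nr <-] := IH; first by move=> k kr; apply: wv; rewrite inE kr orbT.
by rewrite -phiM //; split=> //; exact: normal_subgroupM.
Qed.

End ClosureCharacters.

Section EdgeChains.
Local Open Scope ring_scope.
Variable m : nat.

Lemma sum_pairs (V : zmodType) (f : {set 'I_m} -> V) :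
  (forall s : {set 'I_m}, #|s| != 2%N -> f s = 0) ->
  \sum_s f s = \sum_(ij : 'I_m * 'I_m | (ij.1 < ij.2)%N) f [set ij.1; ij.2]%SET.
Proof.
move=> f2; rewrite [RHS](partition_big (fun ij => [set ij.1; ij.2]%SET) predT) //=.
apply: eq_bigr => s _; have [/cards2P[i [j [ij ->]]]|s2] := boolP (#|s| == 2%N); last first.
  rewrite f2 // big1 // => -[i j] /andP[ij /eqP sE]; case/negP: s2.
  by rewrite -sE cards2 neq_ltn ij.
wlog lt_ij : i j ij / (i < j)%N.
  by move: (ij); rewrite neq_ltn => /orP[] lt; [|rewrite finset.setUC eq_sym in ij *]; apply.
rewrite (big_pred1 (i, j)) // => -[k l] /=; rewrite xpair_eqE.
apply/andP/andP => [[kl /eqP/setP E]|[/eqP-> /eqP->]]; last by rewrite eqxx.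
have := E i; have := E j; have := E k; rewrite !inE !eqxx /= orbT => Ek /esym Ej /esym Ei.
move: Ek Ej Ei; rewrite -!val_eqE /= => /esym Ek Ej Ei.
by move: kl lt_ij ij Ek Ej Ei; rewrite -val_eqE /=; lia.
Qed.

Lemma in_chains_supp (R : nzRingType) D k (z : chain R m) (s : {set 'I_m}) :
  in_chains D k z -> z s != 0 -> s \in D /\ #|s| == k.
Proof. by move=> /forallP/(_ s)/implyP zD /zD/andP[]. Qed.

Lemma in_chains0 (R : nzRingType) D k (z : chain R m) (s : {set 'I_m}) :
  in_chains D k z -> #|s| != k -> z s = 0.
Proof.
by move=> zD sk; apply: contraNeq sk => /(in_chains_supp zD)[].
Qed.

Lemma boundary_edges (R : nzRingType) D (z : chain R m) (k : 'I_m) :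
  in_chains D 2 z ->
  boundary z [set k]%SET = \sum_(ij : 'I_m * 'I_m | (ij.1 < ij.2)%N)
    z [set ij.1; ij.2]%SET * ((k == ij.2)%:R - (k == ij.1)%:R) :> R.
Proof.
move=> zD; rewrite /boundary sum_ffunE.
rewrite (sum_pairs (V := R)) => [|s s2]; last by rewrite (in_chains0 zD s2) scale0r ffunE.
apply: eq_bigr => -[i j] /= ij; have ji : j != i by rewrite -val_eqE gtn_eqF.
rewrite ffunE; congr (_ * _).
have ij' : i != j by rewrite eq_sym.
rewrite sum_ffunE big_setU1 ?inE //= big_set1 !ffunE.
have -> : [set u in [set i; j]%SET | (u < i)%N]%SET = finset.set0.
  by apply/setP => u; rewrite !inE; apply/andP => -[/orP[]/eqP-> //]; lia.
have -> : [set u in [set i; j]%SET | (u < j)%N]%SET = [set i]%SET.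
  apply/setP => u; rewrite !inE; apply/andP/eqP => [[/orP[]/eqP-> //]|->]; first by lia.
  by rewrite eqxx.
rewrite cards0 cards1 expr0 expr1 scale1r scaleN1r.
have -> : ([set i; j] :\ i = [set j])%SET by rewrite setU1K // inE.
have -> : ([set i; j] :\ j = [set i])%SET by rewrite finset.setUC setU1K // inE.
by rewrite !(inj_eq finset.set1_inj).
Qed.

(** Summation by parts turns the pairing of [z] with the coboundary of [U] into a pairing of [U]
    with the boundary of [z]. *)
Lemma boundary_pairing (B : zmodType) D (z : chain int m) (U : 'I_m -> B) :
  in_cycles D 2 z ->
  \sum_(ij : 'I_m * 'I_m | (ij.1 < ij.2)%N)
     (U ij.1 - U ij.2) *~ z [set ij.1; ij.2]%SET = 0.
Proof.
move=> /andP[zD /eqP z0].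
have UE i : U i = \sum_k U k *~ (k == i)%:R.
  by rewrite (bigD1 i) //= eqxx big1 ?addr0 // => k /negPf->.
transitivity (- \sum_k U k *~ boundary z [set k]%SET); last first.
  by rewrite z0 big1 ?oppr0 // => k _; rewrite ffunE mulr0z.
under [in RHS]eq_bigr => k _ do rewrite (boundary_edges k zD) mulrz_sumr.
rewrite exchange_big -sumrN; apply: eq_bigr => -[i j] ij /=.
rewrite [in LHS](UE i) [in LHS](UE j) -sumrB mulrz_suml -sumrN; apply: eq_bigr => k _.
by rewrite mulrC mulrzA; zmod_expand; zmod_ring.
Qed.

End EdgeChains.

Section CubeWords.
Local Open Scope ring_scope.
Variables (m : nat) (G : 'I_m -> groupType) (K : scomplex m).
Notation P := (prod_group G).
Notation "p :-> x" := (p * prod_in x)%g (at level 40, left associativity).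
Notation edge i j := ([set i; j]%SET \in faces K).

Definition cube_sign (J0 I : {set 'I_m}) : int := (-1) ^+ #|J0 :\: I|.

(** The corners pair off along the direction [j], and the two corners of a pair have opposite
    signs. *)
Lemma alternating_split (B : zmodType) (J0 S : {set 'I_m}) (f : {set 'I_m} -> B) j :
  j \in S -> S \subset J0 ->
  \sum_(I in powerset S) f I *~ cube_sign J0 I =
  \sum_(I in powerset (S :\ j)%SET) (f I - f (j |: I)%SET) *~ cube_sign J0 I.
Proof.
move=> jS SJ; have jJ := fintype.subsetP SJ _ jS.
rewrite (bigID (fun I : {set 'I_m} => j \in I)) /= addrC.
rewrite [X in X + _](eq_bigl (fun I => I \in powerset (S :\ j)%SET)); last first.
  by move=> I; rewrite !powersetE subsetD1.
rewrite [X in _ + X](reindex_onto (fun I => (j |: I)%SET) (fun I => (I :\ j)%SET)) /=; last first.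
  by move=> I /andP[_ jI]; rewrite finset.setD1K.
rewrite [X in _ + X](eq_bigl (fun I => I \in powerset (S :\ j)%SET)); last first.
  move=> I; rewrite !powersetE setU11 andbT subsetD1 finset.subUset finset.sub1set jS /=.
  case: (boolP (j \in I)) => jI; last by rewrite setU1K // eqxx.
  by rewrite andbF; apply/andP => -[_ /eqP E]; move: jI; rewrite -E !inE eqxx.
rewrite -big_split; apply: eq_bigr => I; rewrite powersetE subsetD1 => /andP[_ jI] /=.
have -> : cube_sign J0 I = - cube_sign J0 (j |: I)%SET.
  rewrite /cube_sign (cardsD1 j (J0 :\: I)) !inE jI jJ exprS mulN1r; congr (- (_ ^+ _)).
  by apply: eq_card => k; rewrite !inE negb_or andbA.
by zmod_expand; zmod_ring.
Qed.

Variables (J0 : {set 'I_m}) (t0 : P).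

(** For [I] inside [J0] these are the corners of a cube in the direct product, with 1 as its bottom
    corner. *)
Definition restr (I : {set 'I_m}) : P := fun k => if k \in I then t0 k else 1%g.

Lemma restr_step (I : {set 'I_m}) i :
  i \notin I -> (restr I :-> t0 i)%g = restr (i |: I)%SET.
Proof.
move=> iI; apply: functional_extensionality_dep => k.
have [->|ki] := eqVneq k i.
  by rewrite prod_mul_in /restr setU11 (negPf iI) mul1g.
by rewrite prod_mul_in_out // /restr !inE (negPf ki).
Qed.

(** A direction of [J0] outside [J] cancels the sum in pairs. If [J0] lies in [J], a corner other
    than [J0] has a coordinate 1 where [t] is nontrivial, so only the top corner can agree with
    [t]. *)
Lemma alternating_agree (J : {set 'I_m}) (t : P) : (forall j, j \in J -> t j != 1%g) ->
  \sum_(I in powerset J0) agree J t (restr I) *~ cube_sign J0 I =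
  ((J == J0) && [forall (j | j \in J), t j == t0 j])%:R.
Proof.
move=> t1; have [/fintype.subsetP JJ|/fintype.subsetPn[k kJ0 kJ]] := boolP (J0 \subset J);
  last first.
  rewrite (alternating_split _ kJ0) // big1 ?(negPf (contraNneq _ kJ)) => [|->|I] //.
  rewrite powersetE subsetD1 => /andP[_ kI].
  by rewrite -(restr_step kI) agree_out // subrr mul0rz.
have agE p : agree J t p = [forall (k | k \in J), p k == t k]%:R.
  rewrite /agree; case: (boolP [forall (k | k \in J), p k == t k]) => [/forallP pt|].
    by rewrite big1 // => k kJ; have := pt k; rewrite kJ /= => ->.
  rewrite negb_forall => /existsP[k]; rewrite negb_imply => /andP[kJ /negPf kt].
  by rewrite (bigD1 k) //= kt mul0r.
rewrite (bigD1 J0) ?powersetE //= big1 => [|I].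
  rewrite addr0 /cube_sign finset.setDv cards0 expr0 mulr1z agE.
  suff -> : [forall (k | k \in J), restr J0 k == t k] =
      (J == J0) && [forall (k | k \in J), t k == t0 k] by [].
  apply/forallP/andP => [Jt|[/eqP-> /forallP tt] k].
    have JJ0 : J = J0.
      apply/eqP; rewrite finset.eqEsubset andbC; apply/andP; split; first exact/fintype.subsetP.
      apply/fintype.subsetP => k kJ; apply: contraNT (t1 k kJ) => kJ0.
      by have := Jt k; rewrite kJ /restr (negPf kJ0) eq_sym.
    split; first by rewrite JJ0.
    apply/forallP => k; apply/implyP => kJ; have := Jt k.
    by rewrite kJ /restr -JJ0 kJ eq_sym.
  by apply/implyP => kJ; have := tt k; rewrite /restr kJ eq_sym.
rewrite powersetE => /andP[sI nI]; have /fintype.subsetPn[k kJ kI] : ~~ (J0 \subset I).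
  by apply: contraNN nI => sJ; rewrite finset.eqEsubset sI.
rewrite agE; case: forallP => [/(_ k)|_]; last by rewrite mul0rz.
by rewrite JJ //= /restr (negPf kI) eq_sym (negPf (t1 k _)) // JJ.
Qed.

Variables (F : groupType) (N : set F) (eps : P -> forall i, G i -> F).
Hypothesis NN : normal_subgroup N.
Hypothesis squareN : forall p i j (x : G i) (y : G j), i != j -> edge i j ->
  N (square eps p x y).

(* The alternating sum over the cube spanned by [t0] on [J0] isolates the summand of
   [J0] and [t0], and telescopes the contribution of the edges of direction [i] to a
   function of [i] alone. *)
Definition cube_word i j : F :=
  (\prod_(I <- enum (powerset (J0 :\ i :\ j)%SET))
     expz (square eps (restr I) (t0 i) (t0 j)) (cube_sign J0 I))%g.

Definition alternating_sum (B : zmodType) (eta : P -> forall i, G i -> B) i : B :=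
  \sum_(I in powerset (J0 :\ i)%SET) eta (restr I) i (t0 i) *~ cube_sign J0 I.

Lemma cube_word_char (B : zmodType) (phi : F -> B) c (J : {set 'I_m}) (t : P) eta i j :
  closure_char N phi -> square_law K eps phi c J t eta ->
  (forall k, k \in J -> t k != 1%g) ->
  i \in J0 -> j \in J0 -> i != j -> edge i j ->
  N (cube_word i j) /\
  phi (cube_word i j) =
    c i j *~ ((J == J0) && [forall (k | k \in J), t k == t0 k])%:R +
    (alternating_sum eta i - alternating_sum eta j).
Proof.
move=> phiP phiS t1 iJ jJ ij ijK.
have subU k : (J0 :\ k)%SET \subset J0 by exact: subsetDl.
have jJi : j \in (J0 :\ i)%SET by rewrite !inE eq_sym ij jJ.
have iJj : i \in (J0 :\ j)%SET by rewrite !inE ij iJ.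
have JC : (J0 :\ j :\ i = J0 :\ i :\ j)%SET by apply/setP => k; rewrite !inE andbCA.
pose sq I := square eps (restr I) (t0 i) (t0 j).
have [I _|Nw ->] := closure_char_prod NN phiP
    (r := enum (powerset (J0 :\ i :\ j)%SET)) (w := fun I => expz (sq I) (cube_sign J0 I))
    (v := fun I => phi (sq I) *~ cube_sign J0 I).
  by apply: closure_char_expz => //; exact: squareN.
split=> //; rewrite big_enum /=.
(* Every sum is split along both [i] and [j], so that all of them run over the subsets of the same
   set. *)
rewrite -alternating_agree // (alternating_split _ iJ) // (alternating_split _ jJi) //.
rewrite /alternating_sum (alternating_split _ jJi) // (alternating_split _ iJj) // JC.
rewrite mulrz_sumr -sumrB -big_split /=; apply: eq_bigr => I.
rewrite powersetE !subsetD1 => /andP[/andP[_ iI] jI].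
have jiI : j \notin (i |: I)%SET by rewrite !inE negb_or eq_sym ij.
have ijI : i \notin (j |: I)%SET by rewrite !inE negb_or ij.
rewrite /sq phiS // /agree2 !restr_step //.
by rewrite finset.setUCA; zmod_expand; rewrite !mulrzz !mulrzA; zmod_ring.
Qed.

Definition cycle_word (z : chain int m) : F :=
  (\prod_(ij <- enum [pred ij : 'I_m * 'I_m | (ij.1 < ij.2)%N])
     expz (cube_word ij.1 ij.2) (z [set ij.1; ij.2]%SET))%g.

(** The [eta] terms form the coboundary of a function of the vertices, which vanishes on the cycle
    [z]. *)
Lemma cycle_word_char (B : zmodType) (phi : F -> B) c (J : {set 'I_m}) (t : P) eta z :
  closure_char N phi -> square_law K eps phi c J t eta ->
  (forall k, k \in J -> t k != 1%g) ->
  in_cycles (full_subcomplex K J0) 2 z ->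
  N (cycle_word z) /\
  phi (cycle_word z) =
    (\sum_(ij : 'I_m * 'I_m | (ij.1 < ij.2)%N) c ij.1 ij.2 *~ z [set ij.1; ij.2]%SET) *~
    ((J == J0) && [forall (k | k \in J), t k == t0 k])%:R.
Proof.
move=> phiP phiS t1 zC; have /andP[zD _] := zC.
set d := _%:R; pose U := alternating_sum eta.
pose v (ij : 'I_m * 'I_m) := (c ij.1 ij.2 *~ d + (U ij.1 - U ij.2)) *~ z [set ij.1; ij.2]%SET.
pose r := enum [pred ij : 'I_m * 'I_m | (ij.1 < ij.2)%N].
pose w ij := expz (cube_word ij.1 ij.2) (z [set ij.1; ij.2]%SET).
have wv (ij : 'I_m * 'I_m) : (ij.1 < ij.2)%N -> N (w ij) /\ phi (w ij) = v ij.
  rewrite /w /v; move: ij => [i j] /= ij.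
  (* A pair outside the support of [z] need not be an edge; its word enters with exponent 0. *)
  have [->|zij] := eqVneq (z [set i; j]%SET) 0.
    by rewrite mulr0z; split; [exact: normal_subgroup1|exact: (closure_char1 NN phiP)].
  have [] := in_chains_supp zD zij; rewrite inE => /andP[ijK ijJ] _.
  have iJ : i \in J0 by apply: (fintype.subsetP ijJ); rewrite !inE eqxx.
  have jJ : j \in J0 by apply: (fintype.subsetP ijJ); rewrite !inE eqxx orbT.
  have ij' : i != j by rewrite -val_eqE ltn_eqF.
  have [Nij <-] := cube_word_char phiP phiS t1 iJ jJ ij' ijK.
  exact: closure_char_expz.
have [ij|Nr rE] := closure_char_prod NN phiP (r := r) (w := w) (v := v).
  by rewrite mem_enum; exact: wv.
split=> //; rewrite [LHS]rE big_enum /= /v.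
under eq_bigr => ij _ do rewrite mulrzDl mulrzAC.
by rewrite big_split /= (boundary_pairing U zC) addr0 mulrz_suml.
Qed.

End CubeWords.

(** * Homology classes *)

Section ChainClasses.
Local Open Scope ring_scope.
Variables (R : nzRingType) (m : nat) (D : {set {set 'I_m}}) (k : nat).

(** A single edge need not be a cycle, so the flux takes its values in chains modulo boundaries;
    [homology_class_inj] embeds the homology there. *)
Definition bounds : pred (chain R m) :=
  fun z => `[< exists2 c, in_chains D k.+1 c & boundary c = z >].

Lemma bounds_closed : submod_closed bounds.
Proof.
have [c0 cD] := in_chains_closed R D k.+1.
split; first by apply/asboolP; exists 0; rewrite ?linear0.
move=> a y z /asboolP[c Dc cy] /asboolP[d Dd dz]; apply/asboolP.
by exists (a *: c + d); [exact: cD|rewrite boundary_is_linear cy dz].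
Qed.

Definition chain_classes := quotient_module bounds_closed.

Definition chain_class (z : chain R m) : chain_classes := \pi_chain_classes z.

Lemma chain_class_is_additive : zmod_morphism chain_class.
Proof.
move=> x y; apply: (addIr (chain_class y)); rewrite subrK.
by rewrite /chain_class quo_addr_pi subrK.
Qed.

HB.instance Definition _ :=
  GRing.isZmodMorphism.Build (chain R m) chain_classes chain_class
    chain_class_is_additive.

Lemma chain_class_eq0 z : chain_class z = 0 -> bounds z.
Proof.
rewrite -(raddf0 chain_class) => /eqP; rewrite /chain_class.
by rewrite -Quotient.idealrBE subr0.
Qed.

Lemma bounds_class_eq0 z : bounds z -> chain_class z = 0.
Proof.
move=> zb; rewrite -(raddf0 chain_class); apply/eqP; rewrite /chain_class.
by rewrite -Quotient.idealrBE subr0.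
Qed.

Notation H := (quotient_module (in_boundaries_closed R D k)).

Definition cycle_class (z : Defs.cycle R D k) : H := \pi_H z.

Lemma cycle_class_is_additive : zmod_morphism cycle_class.
Proof.
move=> x y; apply: (addIr (cycle_class y)); rewrite subrK.
by rewrite /cycle_class quo_addr_pi subrK.
Qed.

HB.instance Definition _ :=
  GRing.isZmodMorphism.Build (Defs.cycle R D k) H cycle_class cycle_class_is_additive.

Lemma cycle_class_eq x y : cycle_class x = cycle_class y <-> in_boundaries (x - y).
Proof.
rewrite /cycle_class; split=> [/eqP|xy]; last apply/eqP;
  by rewrite -(@Quotient.idealrBE _ (submod_pred (in_boundaries_closed R D k))).
Qed.

Lemma cycle_class_surj (h : H) : exists z, cycle_class z = h.
Proof. by exists (repr h); exact: reprK. Qed.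

Definition homology_class (h : H) : chain_classes := chain_class (val (repr h)).

Lemma homology_class_cycle z : homology_class (cycle_class z) = chain_class (val z).
Proof.
apply/eqP; rewrite -subr_eq0 -raddfB -raddfB; apply/eqP/bounds_class_eq0.
have /cycle_class_eq/asboolP zb : cycle_class (repr (cycle_class z)) = cycle_class z.
  exact: reprK.
exact/asboolP.
Qed.

Lemma homology_class_is_additive : zmod_morphism homology_class.
Proof.
move=> x y; have [[u <-] [v <-]] := (cycle_class_surj x, cycle_class_surj y).
by rewrite -raddfB !homology_class_cycle !raddfB.
Qed.

HB.instance Definition _ :=
  GRing.isZmodMorphism.Build H chain_classes homology_class homology_class_is_additive.

Lemma homology_class_inj : injective homology_class.
Proof.
move=> x y; have [[u <-] [v <-]] := (cycle_class_surj x, cycle_class_surj y).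
rewrite !homology_class_cycle => uv.
have /chain_class_eq0/asboolP uvb : chain_class (val (u - v)) = 0.
  by rewrite !raddfB /= uv subrr.
by apply/cycle_class_eq; exact/asboolP.
Qed.

End ChainClasses.

Section EdgeClasses.
Local Open Scope ring_scope.
Variables (m : nat) (K : scomplex m).
Hypothesis Kflag : flag K.
Notation edge i j := ([set i; j]%SET \in faces K).

Definition edge_class J (i j : 'I_m) : chain_classes int (full_subcomplex K J) 2 :=
  if (i < j)%N then chain_class _ _ (chain_of int [set i; j]%SET)
  else if (j < i)%N then - chain_class _ _ (chain_of int [set i; j]%SET) else 0.

Lemma edge_classN J i j : edge_class J j i = - edge_class J i j.
Proof.
rewrite /edge_class finset.setUC; case: (ltngtP i j); rewrite ?opprK ?oppr0 //.
Qed.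

Lemma edge_classii J i : edge_class J i i = 0.
Proof. by rewrite /edge_class ltnn. Qed.

Lemma boundary_chain_of (R : nzRingType) (s : {set 'I_m}) :
  boundary (chain_of R s) =
  \sum_(v in s) (-1) ^+ #|[set u in s | (u < v)%N]%SET| *: chain_of R (s :\ v)%SET.
Proof.
rewrite /boundary (bigD1 s) //= [X in _ + X]big1 => [|u us].
  by rewrite addr0 ffunE eqxx scale1r.
by rewrite ffunE (negPf us) scale0r.
Qed.

(** Flagness enters here: the three edges span a 2-face, whose boundary is the relation. *)
Lemma edge_class_triangle (J : {set 'I_m}) i j k : i \in J -> j \in J -> k \in J ->
  edge i j -> edge i k -> edge j k -> (i < j)%N -> (j < k)%N ->
  edge_class J i j + edge_class J j k = edge_class J i k.
Proof.
move=> iJ jJ kJ ij ik jk lij ljk; have lik := ltn_trans lij ljk.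
rewrite /edge_class lij ljk lik; apply/eqP; rewrite -subr_eq0 -raddfD -raddfB.
apply/eqP/bounds_class_eq0/asboolP; exists (chain_of int [set i; j; k]%SET).
  apply/forallP => s; rewrite ffunE; case: (eqVneq s _) => [->|]; rewrite ?eqxx //.
  rewrite oner_eq0 /= inE; apply/andP; split; [apply/andP; split|].
  - apply: Kflag => u v; rewrite !inE => /orP[/orP[]|] /eqP-> /orP[/orP[]|] /eqP-> //;
      rewrite ?finset.setUid ?face1 //; by rewrite finset.setUC.
  - by apply/fintype.subsetP => u; rewrite !inE => /orP[/orP[]|] /eqP->.
  - by rewrite -finset.setUA cardsU1 cards2 !inE -!val_eqE /=; lia.
have ij' : i != j by rewrite -val_eqE /=; lia.
have ik' : i != k by rewrite -val_eqE /=; lia.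
have jk' : j != k by rewrite -val_eqE /=; lia.
rewrite boundary_chain_of -finset.setUA big_setU1 ?inE ?negb_or ?ij' //=.
rewrite big_setU1 ?inE //= big_set1.
have -> : [set u in i |: [set j; k] | (u < i)%N]%SET = finset.set0.
  by apply/setP => u; rewrite !inE; apply/negbTE; rewrite negb_and !negb_or -!val_eqE /=; lia.
have -> : [set u in i |: [set j; k] | (u < j)%N]%SET = [set i]%SET.
  by apply/setP => u; rewrite !inE -!val_eqE /=; lia.
have -> : [set u in i |: [set j; k] | (u < k)%N]%SET = [set i; j]%SET.
  by apply/setP => u; rewrite !inE -!val_eqE /=; lia.
rewrite cards0 cards1 cards2 ij' expr0 expr1 scale1r scaleN1r -signr_odd expr0 scale1r.
have -> : ((i |: [set j; k]) :\ i = [set j; k])%SET by rewrite setU1K // !inE negb_or ij'.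
have -> : ((i |: [set j; k]) :\ j = [set i; k])%SET.
  by apply/setP => u; rewrite !inE -!val_eqE /=; lia.
have -> : ((i |: [set j; k]) :\ k = [set i; j])%SET.
  by apply/setP => u; rewrite !inE -!val_eqE /=; lia.
by zmod_ring.
Qed.

(** This is the condition on [c] in [potential_exists]. By antisymmetry it reduces to
    [edge_class_triangle] for each position of [k] relative to [i < j]. *)
Lemma edge_class_cocycle (J : {set 'I_m}) i j k : i \in J -> j \in J -> k \in J -> i != j ->
  edge i j -> edge i k -> edge j k ->
  edge_class J i j = edge_class J i k - edge_class J j k.
Proof.
move=> iJ jJ kJ ij Kij Kik Kjk.
have [Kji [Kki Kkj]] : edge j i /\ edge k i /\ edge k j.
  by rewrite ![[set k; _]%SET]finset.setUC finset.setUC.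
have [<-|ki] := eqVneq k i; first by rewrite edge_classii sub0r edge_classN.
have [<-|kj] := eqVneq k j; first by rewrite edge_classii subr0.
have T := edge_class_triangle.
have N := edge_classN J.
wlog lij : i j ij ki kj iJ jJ Kij Kji Kki Kkj Kik Kjk / (i < j)%N.
  move: (ij); rewrite neq_ltn => /orP[] lt H; first exact: H.
  by rewrite N H // 1?eq_sym // opprB.
case: (ltngtP k i) => [lki|lik|/val_inj E]; last by rewrite E eqxx in ki.
  by rewrite (N k i) (N k j) -(T J k i j) //; zmod_ring.
case: (ltngtP k j) => [lkj|ljk|/val_inj E]; last by rewrite E eqxx in kj.
  by rewrite -(T J i k j) // (N k j); zmod_ring.
by rewrite -(T J i j k) // addrK.
Qed.

Lemma chain_class_edges (J : {set 'I_m}) (z : chain int m) : in_chains (full_subcomplex K J) 2 z ->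
  chain_class _ 2 z = \sum_(ij : 'I_m * 'I_m | (ij.1 < ij.2)%N)
    edge_class J ij.1 ij.2 *~ z [set ij.1; ij.2]%SET.
Proof.
move=> zD; have zE : z = \sum_s chain_of int s *~ z s.
  apply/ffunP => s; rewrite sum_ffunE (bigD1 s) //= big1 => [|u us].
    by rewrite addr0 -scaler_int !ffunE eqxx intz [RHS]mulr1.
  by rewrite -scaler_int !ffunE eq_sym (negPf us) scaler0.
rewrite {1}zE raddf_sum sum_pairs => [|s s2]; last by rewrite (in_chains0 zD s2) mulr0z raddf0.
by apply: eq_bigr => -[i j] /= ij; rewrite raddfMz /edge_class ij.
Qed.
End EdgeClasses.

(** * Surjection onto the direct sum of homology groups *)

Section DirectSums.
Local Open Scope ring_scope.
Variables (I : Type) (V : I -> zmodType).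

Definition single_val (i0 : I) (x : V i0) (i : I) : V i :=
  match pselect (i0 = i) with
  | left e => eq_rect i0 (fun j => V j : Type) x i e
  | right _ => 0
  end.

Lemma single_val_in i0 (x : V i0) : single_val x i0 = x.
Proof.
rewrite /single_val; case: pselect => // e.
by rewrite (Prop_irrelevance e (erefl i0)).
Qed.

Lemma single_val_out i0 (x : V i0) i : i0 <> i -> single_val x i = 0.
Proof. by rewrite /single_val; case: pselect. Qed.

Lemma single_val_finite i0 (x : V i0) : finitely_supported (single_val x).
Proof.
apply/asboolP; apply: (@sub_finite_set _ _ [set i0]); last exact: finite_set1.
move=> i /=; have [e|ii] := pselect (i0 = i); first by move=> _; exact: esym.
by rewrite single_val_out // eqxx.
Qed.

Definition single i0 (x : V i0) : direct_sum V := DirectSum (single_val_finite x).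

Lemma direct_sum_valB (f g : direct_sum V) i : val (f - g) i = val f i - val g i.
Proof. by []. Qed.

Lemma direct_sum_val0 i : val (0 : direct_sum V) i = 0.
Proof. by []. Qed.

Lemma direct_sum_ind (Q : direct_sum V -> Prop) :
  (forall f g, Q f -> Q g -> Q (f - g)) -> (forall i x, Q (@single i x)) ->
  Q 0 -> forall f, Q f.
Proof.
move=> QB Q1 Q0 f.
have QD g h : Q g -> Q h -> Q (g + h).
  by move=> Qg Qh; rewrite -[h]opprK -[- h]sub0r; apply: (QB) => //; exact: (QB).
have [s fs] : exists s : seq {classic I}, forall i, val f i != 0 -> (i : {classic I}) \in s.
  have /(@finite_seqP {classic I})[s sE] := direct_sum_finite f.
  by exists s => i fi; have : [set` s] i by rewrite -sE.
elim: s f fs => [|i s IH] f fs.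
  suff -> : f = 0 by [].
  by apply: direct_sumP => i; apply/eqP; apply: contraT => /fs.
rewrite -(subrK (single (val f i)) f); apply: QD; last exact: Q1.
apply: IH => j.
rewrite direct_sum_valB; have -> : val (single (val f i)) j = single_val (val f i) j by [].
have [ij|ij] := pselect (i = j); first by subst j; rewrite single_val_in subrr eqxx.
rewrite single_val_out // subr0 => /fs; rewrite inE => /orP[/eqP ji|//].
by case: ij.
Qed.
End DirectSums.

Section OrderedSection.
Variables (m : nat) (G : 'I_m -> groupType) (K : scomplex m).
Notation GP := (graph_product G K).
Notation P := (prod_group G).
Notation "g :>> x" := (g * graph_product_in K x) (at level 40, left associativity).
Notation "p :-> x" := (p * prod_in x) (at level 40, left associativity).
Notation pr := (@graph_product_proj m G K).

Definition ordered_section (p : P) : GP :=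
  \prod_(k <- enum 'I_m) graph_product_in K (p k).

Lemma graph_product_proj_ordered p : pr (ordered_section p) = p.
Proof.
suff H (l : seq 'I_m) k : uniq l ->
    pr (\prod_(j <- l) graph_product_in K (p j)) k = if k \in l then p k else 1.
  by apply: functional_extensionality_dep => k; rewrite H ?enum_uniq // mem_enum.
elim: l => [_|j l IH /= /andP[jl ul]].
  by rewrite big_nil (morph_one (@graph_product_projM _ _ _)).
rewrite big_cons graph_product_projM prod_mulE IH // graph_product_proj_in inE.
have [->|kj] := eqVneq k j; first by rewrite /prod_in dfwith_in (negPf jl) mulg1.
by rewrite /prod_in dfwith_out 1?eq_sym // [LHS]mul1g.
Qed.

(** The factors come in increasing order, so a letter beyond the support of [p] is appended without
    commutations. The edge words of such steps therefore represent 1. *)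
Lemma ordered_section_step (p : P) i (x : G i) :
  (forall k : 'I_m, (i <= k)%N -> p k = 1) ->
  ordered_section p :>> x = ordered_section (p :-> x).
Proof.
move=> p1; rewrite /ordered_section.
suff H (l : seq 'I_m) : pairwise (fun j k : 'I_m => (j < k)%N) l -> i \in l ->
    (\prod_(k <- l) graph_product_in K (p k)) :>> x =
    \prod_(k <- l) graph_product_in K ((p :-> x) k).
  apply: H; last by rewrite mem_enum.
  rewrite -(pairwise_map val ltn) val_enum_ord -(sorted_pairwise ltn_trans).
  exact: iota_ltn_sorted.
elim: l => [//|j l IH] /= /andP[/allP jl ul].
rewrite !big_cons inE; have [ij _|ij /= il] := eqVneq i j; last first.
  have ji : (j < i)%N by exact: jl.
  by rewrite -mulgA IH // prod_mul_in_out // eq_sym.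
subst j; rewrite p1 // graph_product_in1 mul1g prod_mul_in p1 // mul1g.
have -> : \prod_(k <- l) graph_product_in K (p k) = 1.
  by rewrite big1_seq // => k /andP[_ /jl /ltnW ik]; rewrite p1 // graph_product_in1.
rewrite mul1g big1_seq ?mulg1 // => k /andP[_ /jl ik].
rewrite prod_mul_in_out ?p1 ?graph_product_in1 //; first exact: ltnW.
by rewrite -val_eqE gtn_eqF.
Qed.
End OrderedSection.

Section AdditiveWords.
Local Open Scope ring_scope.
Variable F : groupType.

Definition additive_word (B : zmodType) (a : F -> B) : Prop :=
  forall u v, a (u * v)%g = a u + a v.

Variables (B : zmodType) (a : F -> B).
Hypothesis aM : additive_word a.

Lemma additive_word1 : a 1%g = 0.
Proof. by apply: (addrI (a 1%g)); rewrite -aM mulg1 addr0. Qed.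

Lemma additive_wordV u : a u^-1%g = - a u.
Proof. by apply: (addrI (a u)); rewrite -aM mulgV additive_word1 subrr. Qed.

Lemma additive_word_char N : closure_char N a.
Proof.
split=> [u v _ _|u v _]; first exact: aM.
by rewrite !aM additive_wordV; zmod_ring.
Qed.

End AdditiveWords.

(** * Relators that realize homology classes *)

Section CartPresentation.
Local Open Scope ring_scope.
Variables (m : nat) (G : 'I_m -> groupType) (K : scomplex m).
Notation GP := (graph_product G K).
Notation P := (prod_group G).
Notation "g :>> x" := (g * graph_product_in K x)%g (at level 40, left associativity).
Notation "p :-> x" := (p * prod_in x)%g (at level 40, left associativity).
Notation pr := (@graph_product_proj m G K).
Notation edge i j := ([set i; j]%SET \in faces K).

Variable Pr : presentation (Cart G K).
Notation F := (free_group (gens Pr)).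
Notation N := (normal_closure (rels Pr)).

Definition cart_proj (w : F) : GP := val (pres_proj w).

Lemma cart_projM : {morph cart_proj : u v / (u * v)%g}.
Proof. by move=> u v; rewrite /cart_proj pres_projM. Qed.

Lemma proj_cart_proj w : pr (cart_proj w) = 1%g.
Proof. by apply/eqP; exact: (valP (pres_proj w)). Qed.

Lemma cart_proj_eq1 w : (cart_proj w = 1%g) <-> N w.
Proof.
by rewrite -pres_proj_eq1; split=> [w1|]; [exact: val_inj|rewrite /cart_proj => ->].
Qed.

Lemma cart_proj_surj g : pr g = 1%g -> exists w, cart_proj w = g.
Proof.
move=> /eqP g1; have [w wE] := @pres_proj_surj _ Pr (MkCart g1).
by exists w; rewrite /cart_proj wE.
Qed.

Notation s := (@ordered_section m G K).

(** These words lift the Schreier generators of the Cartesian subgroup for the transversal [s]. *)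
Lemma edge_words_exist : exists eps : P -> forall i, G i -> F,
  forall p i (x : G i), cart_proj (eps p i x) = (s p :>> x * (s (p :-> x))^-1)%g.
Proof.
have H (p : P) i : exists f : G i -> F,
    forall x : G i, cart_proj (f x) = (s p :>> x * (s (p :-> x))^-1)%g.
  suff /choice[f fE] : forall x : G i, exists w : F,
      cart_proj w = (s p :>> x * (s (p :-> x))^-1)%g by exists f.
  move=> x; apply: cart_proj_surj.
  rewrite graph_product_projM graph_product_projX (morph_inv (@graph_product_projM _ _ _)).
  by rewrite !graph_product_proj_ordered mulgV.
have H2 (p : P) : exists f : forall i, G i -> F, forall i (x : G i),
    cart_proj (f i x) = (s p :>> x * (s (p :-> x))^-1)%g.
  exists (fun i => sval (cid (H p i))) => i; exact: svalP (cid (H p i)).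
exists (fun p => sval (cid (H2 p))) => p; exact: svalP (cid (H2 p)).
Qed.

Lemma N_normal : normal_subgroup N. Proof. exact: normal_closureP. Qed.

Section EdgeWords.
Variable eps : P -> forall i, G i -> F.
Hypothesis epsE : forall p i (x : G i),
  cart_proj (eps p x) = (s p :>> x * (s (p :-> x))^-1)%g.

Lemma square_in_closure p i j (x : G i) (y : G j) :
  i != j -> edge i j -> N (square eps p x y).
Proof.
move=> ij ijK; apply/cart_proj_eq1.
have cV w : cart_proj w^-1%g = (cart_proj w)^-1%g by exact/morph_inv/cart_projM.
have C : (p :-> y :-> x = p :-> x :-> y :> P)%g.
  by rewrite -mulgA -(prod_in_comm _ _ ij) mulgA.
rewrite /square 3!cart_projM 2!cV !epsE C commutator_of_square.
by rewrite (graph_product_in_comm _ _ ij ijK) mulgK mulgV mulg1 mulgV.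
Qed.

(** An exponent sum carries no flux: its value on a square is the coboundary of its values on the
    edges. *)
Lemma additive_word_law (B : zmodType) (a : F -> B) (aM : additive_word a) J t :
  square_law K eps a (fun _ _ => 0) J t (fun p i x => a (eps p x)).
Proof.
move=> p i j x y _ _; rewrite mul0rz /square !aM !(additive_wordV aM).
by zmod_ring.
Qed.

End EdgeWords.

Definition tuple_point J (t : nontrivial_tuples G J) : P := fun k =>
  match @idP (k \in J) with
  | ReflectT kJ => val (t (exist _ k kJ))
  | ReflectF _ => 1%g
  end.

Lemma tuple_point_in J (t : nontrivial_tuples G J) k (kJ : k \in J) :
  tuple_point t k = val (t (exist _ k kJ)).
Proof.
rewrite /tuple_point; case: {-}_ / idP => // kJ'.
by rewrite (bool_irrelevance kJ' kJ).
Qed.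

Lemma tuple_point_neq1 J (t : nontrivial_tuples G J) k : k \in J -> tuple_point t k != 1%g.
Proof. by move=> kJ; rewrite tuple_point_in; exact: (valP (t _)). Qed.

Lemma tuple_point_inj J (t t' : nontrivial_tuples G J) :
  (forall k, k \in J -> tuple_point t k = tuple_point t' k) -> t = t'.
Proof.
move=> tt; apply: functional_extensionality_dep => -[k kJ]; apply: val_inj.
by rewrite -!tuple_point_in tt.
Qed.

Notation I := {J : {set 'I_m} & nontrivial_tuples G J}.
Notation V := (fun i : I => reduced_homology int 1 (full_subcomplex K (tag i)) : zmodType).

Hypothesis Kflag : flag K.

Lemma flux_family_exists eps :
  (forall p i (x : G i), cart_proj (eps p i x) = (s p :>> x * (s (p :-> x))^-1)%g) ->
  exists psi : forall i : I, F -> chain_classes int (full_subcomplex K (tag i)) 2,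
  forall i, closure_char N (psi i) /\
    exists eta, square_law K eps (psi i) (edge_class K (tag i)) (tag i)
      (tuple_point (tagged i)) eta.
Proof.
move=> epsE.
have H (i : I) : exists psi : F -> chain_classes int (full_subcomplex K (tag i)) 2,
    closure_char N psi /\
    exists eta, square_law K eps psi (edge_class K (tag i)) (tag i) (tuple_point (tagged i)) eta.
  have [j k l jJ kJ lJ jk|b bP] := @potential_exists m G K _ (edge_class K (tag i)) (tag i)
      (tuple_point (tagged i)) (edge_classN K (tag i)).
    exact: edge_class_cocycle.
  have [psi psiN psiS] := flux_char bP cart_projM proj_cart_proj.
  exists psi; split; last by apply: psiS epsE; exact: graph_product_proj_ordered.
  case: psiN => psiM psiJ; split=> [u v|u v /cart_proj_eq1 u1]; last exact: psiJ.
  by move=> /cart_proj_eq1 u1 /cart_proj_eq1 v1; exact: psiM.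
exists (fun i => sval (cid (H i))) => i; exact: svalP (cid (H i)).
Qed.

(** Surjectivity for Hopf's formula. A class in one summand is realized by the cycle word of a
    representative, whose flux for every other index is zero. *)
Lemma module_words_exist
    (psi : forall i : I, F -> chain_classes int (full_subcomplex K (tag i)) 2) eps :
  (forall p i (x : G i), cart_proj (eps p i x) = (s p :>> x * (s (p :-> x))^-1)%g) ->
  (forall i, closure_char N (psi i) /\
    exists eta, square_law K eps (psi i) (edge_class K (tag i)) (tag i)
      (tuple_point (tagged i)) eta) ->
  forall x : M_module G K, exists w, [/\ N w,
    forall (B : zmodType) (a : F -> B), additive_word a -> a w = 0 &
    forall i, psi i w = homology_class (val x i)].
Proof.
move=> epsE psiP; have NN := N_normal; have sqN := square_in_closure epsE.
elim/direct_sum_ind => [x y [u [Nu au ux]] [v [Nv av vy]]|i0 h|].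
- exists (u * v^-1)%g; split=> [|B a aM|i].
  + by apply: (normal_subgroupM NN) => //; exact: (normal_subgroupV NN).
  + by rewrite aM additive_wordV // au // av // subr0.
  + have [psiN _] := psiP i; rewrite (proj1 psiN) //; last exact: (normal_subgroupV NN).
    by rewrite (closure_charV NN psiN) // ux vy direct_sum_valB raddfB.
- have [z <-] := cycle_class_surj h.
  pose J0 := tag i0; pose t0 := tuple_point (tagged i0).
  exists (cycle_word J0 t0 eps (val z)).
  have zC : in_cycles (full_subcomplex K J0) 2 (val z) by exact: (valP z).
  split=> [|B a aM|i].
  + have [psiN [eta psiS]] := psiP i0.
    by case: (cycle_word_char t0 NN sqN psiN psiS (tuple_point_neq1 (tagged i0)) zC).
  (* With [c = 0] any index computes [a]; the empty set makes the condition on the tuple void. *)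
  + have t1 k : k \in finset.set0 -> t0 k != 1%g by rewrite inE.
    have [_ ->] := cycle_word_char t0 NN sqN (additive_word_char aM N)
      (additive_word_law eps aM finset.set0 t0) t1 zC.
    by rewrite big1 ?mul0rz // => ij _; rewrite mul0rz.
  + have [psiN [eta psiS]] := psiP i.
    have [_ ->] := cycle_word_char t0 NN sqN psiN psiS (tuple_point_neq1 (tagged i)) zC.
    have -> : val (@single I V i0 (cycle_class z)) i = @single_val I V i0 (cycle_class z) i by [].
    have [ii|ii] := pselect (i0 = i).
      subst i; rewrite single_val_in homology_class_cycle eqxx.
      case: forallP => [_|[k]]; last by rewrite eqxx implybT.
      by rewrite mulr1z -chain_class_edges //; case/andP: zC.
    rewrite single_val_out // raddf0; case: eqP => [JJ|_]; last by rewrite mulr0z.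
    case: forallP => [tt|_]; last by rewrite mulr0z.
    case: ii; move: tt JJ; rewrite /t0 /J0.
    case: i i0 {psiN psiS eta h z zC J0 t0} => [J t] [J1 t1] /= tt JJ.
    subst J1; congr existT; apply: tuple_point_inj => k kJ; have := tt k.
    by rewrite kJ => /eqP.
- exists 1%g; split=> [|B a aM|i]; first exact: (normal_subgroup1 NN).
    exact: additive_word1.
  by have [psiN _] := psiP i; rewrite (closure_char1 NN psiN) direct_sum_val0 raddf0.
Qed.
End CartPresentation.

(** * Subgroups of free abelian groups *)

(** Least elements of sets with at most three points give totality, antisymmetry and transitivity;
    antisymmetry uses the uniqueness of the least element. *)
Lemma well_order_exists (T : choiceType) : exists R : rel T,
  [/\ total R, antisymmetric R, transitive R &
   forall A : set T, A !=set0 -> exists2 x, A x & forall y, A y -> R x y].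
Proof.
have [R wo] := wochoice.well_ordering_principle T.
have mini (A : {pred T}) x : x \in A -> exists2 z, z \in A & forall y, y \in A -> R z y.
  by move=> xA; have [|z [[zA zmin] _]] := wo A; [exists x|exists z].
have Rtot : total R.
  move=> x y; have [|z] := mini (pred2 x y) x; first by rewrite !inE eqxx.
  rewrite !inE => /orP[]/eqP-> zmin; [rewrite zmin ?orbT|rewrite (zmin x) ?orbT] => //.
    by rewrite !inE eqxx orbT.
  by rewrite !inE eqxx.
have Rxx x : R x x by have := Rtot x x; rewrite orbb.
have Ranti : antisymmetric R.
  move=> x y /andP[xy yx]; have [|z [_ zu]] := wo (pred2 x y).
    by exists x; rewrite !inE eqxx.
  rewrite -(zu x) ?(zu y) //; split; rewrite ?inE ?eqxx ?orbT // => u; rewrite !inE.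
    by move=> /orP[]/eqP->.
  by move=> /orP[]/eqP->.
exists R; split=> //.
  move=> y x z xy yz; have [|w] := mini (pred3 x y z) x; first by rewrite !inE eqxx.
  rewrite !inE => /or3P[]/eqP-> wmin.
  - by apply: wmin; rewrite !inE eqxx !orbT.
  - have yx : R y x by apply: wmin; rewrite !inE eqxx.
    by rewrite (Ranti x y) // xy.
  - have zy : R z y by apply: wmin; rewrite !inE eqxx orbT.
    by rewrite (Ranti z y) // zy.
move=> A [x Ax]; have [|z zA zmin] := mini [pred x | `[< A x >]] x.
  exact/asboolP.
exists z; first exact/asboolP.
by move=> y Ay; apply: zmin; exact/asboolP.
Qed.

Lemma total_order_max (T : eqType) (R : rel T) (l : seq T) :
  total R -> transitive R -> l != [::] ->
  exists2 r, r \in l & forall q, q \in l -> R q r.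
Proof.
move=> Rtot Rtr; elim: l => [//|x l IH] _; have [->|/IH[r rl rmax]] := eqVneq l [::].
  by exists x => [|q]; rewrite inE ?eqxx // => /eqP->; have := Rtot x x; rewrite orbb.
have [xr|rx] := orP (Rtot x r).
  exists r => [|q]; first by rewrite inE rl orbT.
  by rewrite inE => /orP[/eqP->|/rmax].
exists x => [|q]; first by rewrite inE eqxx.
rewrite inE => /orP[/eqP->|/rmax qr]; first by have := Rtot x x; rewrite orbb.
exact: Rtr qr rx.
Qed.

Section IntegralVectors.
Local Open Scope ring_scope.
Variable T : choiceType.

Definition int_vector := direct_sum (fun _ : T => int : zmodType).
Implicit Types f g : int_vector.

Lemma support_seq f : exists2 s : seq T, uniq s & forall r, val f r != 0 -> r \in s.
Proof.
have /finite_seqP[s sE] := direct_sum_finite f.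
exists (undup s); first exact: undup_uniq.
by move=> r fr; rewrite mem_undup; have : [set` s] r by rewrite -sE.
Qed.

Section Pairing.
Variables (B : zmodType) (phi : T -> B).

Definition pairing f : B := \sum_(r \in [set: T]) phi r *~ val f r.

Lemma pairingE f (s : seq T) : uniq s -> (forall r, val f r != 0 -> r \in s) ->
  pairing f = \sum_(r <- s) phi r *~ val f r.
Proof.
move=> us fs; rewrite /pairing (fsbigE s) //= => [|r _ rs].
  by apply: eq_bigl => r; rewrite in_setT.
by have [->|/fs] := eqVneq (val f r) 0; [rewrite mulr0z|rewrite (negPf rs)].
Qed.

Lemma pairing_is_additive : zmod_morphism pairing.
Proof.
move=> f g; have [[s us fs] [t ut gt]] := (support_seq f, support_seq g).
have uh : uniq (undup (s ++ t)) by exact: undup_uniq.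
rewrite (pairingE (f := f) uh) => [|r /fs]; last by rewrite mem_undup mem_cat => ->.
rewrite (pairingE (f := g) uh) => [|r /gt]; last by rewrite mem_undup mem_cat => ->; rewrite orbT.
rewrite (pairingE uh) => [|r].
  rewrite -sumrB; apply: eq_bigr => r _.
  by rewrite direct_sum_valB mulrzDr mulrNz.
rewrite direct_sum_valB mem_undup mem_cat; have [-> /=|/fs-> //] := eqVneq (val f r) 0.
by rewrite sub0r oppr_eq0 => /gt->; rewrite orbT.
Qed.

HB.instance Definition _ :=
  GRing.isZmodMorphism.Build int_vector B pairing pairing_is_additive.

Lemma pairing_single r : pairing (@single T (fun=> int : zmodType) r (1 : int)) = phi r.
Proof.
rewrite (@pairingE _ [:: r]) // => [|q].
  by rewrite big_seq1 (_ : val _ r = 1) ?mulr1z //; exact: single_val_in.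
apply: contraNT; rewrite inE => qr.
rewrite (_ : val _ q = 0) //; apply: (@single_val_out _ (fun=> int : zmodType)).
by move=> rq; rewrite rq eqxx in qr.
Qed.

End Pairing.

(* A subgroup of a free abelian group is generated by elements whose leading
   coefficients, for a well-order of the basis, generate the ideals of leading
   coefficients; they are indexed by a subset of the basis. *)
Lemma triangular_generators (L : set int_vector) :
  L 0 -> (forall f g, L f -> L g -> L (f - g)) ->
  exists (R : rel T) (S : set T) (k : T -> int_vector),
  [/\ total R /\ antisymmetric R /\ transitive R,
      forall r, S r -> L (k r),
      forall r, S r -> val (k r) r != 0 /\ forall q, val (k r) q != 0 -> R q r &
      forall Q : int_vector -> Prop, Q 0 -> (forall f g, Q f -> Q g -> Q (f - g)) ->
        (forall r, S r -> Q (k r)) -> forall f, L f -> Q f].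
Proof.
move=> L0 LB; have [R [Rtot Ranti Rtr Rmin]] := well_order_exists T.
pose below r f := forall q, val f q != 0 -> R q r.
pose S := [set r | exists f, [/\ L f, below r f & val f r != 0]].
have kP r : exists k, S r -> [/\ L k, below r k, val k r != 0 &
    forall f, L f -> below r f -> val f r != 0 -> (`|val k r| <= `|val f r|)%N].
  have [[f [Lf bf fr]]|nS] := pselect (S r); last by exists 0.
  pose p n := `[< exists g, [/\ L g, below r g, val g r != 0 & `|val g r|%N = n] >].
  have exp : exists n, p n by exists `|val f r|%N; apply/asboolP; exists f.
  have [_ /asboolP[k [Lk bk kr <-]] kmin] := ex_minnP exp.
  by exists k => _; split=> // g Lg bg gr; apply: kmin; apply/asboolP; exists g.
have [k kE] := choice kP.
exists R, S, k; split=> [//|r /kE[]//|r /kE[_ bk kr _]//|Q Q0 QB Qk].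
have QD f g : Q f -> Q g -> Q (f + g).
  move=> Qf Qg; rewrite -[g]opprK; apply: (QB) => //; rewrite -sub0r; exact: (QB).
have QZ f (n : int) : Q f -> Q (f *~ n).
  move=> Qf; have QN (i : nat) : Q (f *+ i).
    by elim: i => [|i IH]; rewrite ?mulr0n // mulrS; exact: QD.
  by case: n => i; [exact: QN|rewrite NegzE mulrNz -sub0r; apply: (QB) => //; exact: QN].
have LD f g : L f -> L g -> L (f + g).
  move=> Qf Qg; rewrite -[g]opprK; apply: (LB) => //; rewrite -sub0r; exact: (LB).
have LZ f (n : int) : L f -> L (f *~ n).
  move=> Qf; have QN (i : nat) : L (f *+ i).
    by elim: i => [|i IH]; rewrite ?mulr0n // mulrS; exact: LD.
  by case: n => i; [exact: QN|rewrite NegzE mulrNz -sub0r; apply: (LB) => //; exact: QN].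
have lead f : f != 0 -> exists2 r, val f r != 0 & below r f.
  move=> f0; have [s _ fs] := support_seq f.
  have [|r] := total_order_max (l := [seq q <- s | val f q != 0]) Rtot Rtr.
    apply: contraNneq f0 => s0; apply/eqP/direct_sumP => q; apply/eqP; apply: contraT => fq.
    by have : q \in [::] by rewrite -s0 mem_filter fq fs.
  rewrite mem_filter => /andP[fr _] rmax; exists r => // q fq.
  by apply: rmax; rewrite mem_filter fq fs.
suff H r f : L f -> below r f -> Q f.
  move=> f Lf; have [->//|/lead[r _ bf]] := eqVneq f 0; exact: H bf.
have valZ (h : int_vector) n q : val (h *~ n) q = val h q *~ n :> int.
  case: n => n; rewrite ?NegzE ?mulrNz -?pmulrn.
    by elim: n => // n IH; rewrite !mulrS -IH.
  congr (- _); by elim: (n.+1) => // i IH; rewrite !mulrS -IH.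
move=> Lf bf; apply: contrapT => nQ.
(* Transfinite descent: [r0] is the least bound for the support of a counterexample. *)
have [|{bf nQ Lf}r0 [{}f [Lf bf nQ]] r0min] := Rmin [set r | exists f, [/\ L f, below r f & ~ Q f]].
  by exists r, f.
have Q_lower g : L g -> below r0 g -> val g r0 = 0 -> Q g.
  move=> Lg bg g0; have [->//|/lead[q gq bq]] := eqVneq g 0; apply: contrapT => nQg.
  have r0q : R r0 q by apply: r0min; exists g.
  have qr : q = r0 by apply: Ranti; rewrite (bg _ gq) r0q.
  by rewrite qr g0 eqxx in gq.
apply: nQ; have [f0|f0] := eqVneq (val f r0) 0; first exact: Q_lower.
have Sr : S r0 by exists f.
have [Lk bk kr kmin] := kE _ Sr.
(* After division by the minimal leading coefficient, the remainder at [r0] is too small to be a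
   leading coefficient. So it is 0, and [Q_lower] applies to [g]. *)
pose n := (val f r0 %/ val (k r0) r0)%Z; pose g := f - k r0 *~ n.
have Lg : L g by apply: LB => //; exact: LZ.
have bg : below r0 g.
  move=> q; rewrite /g direct_sum_valB valZ; have [->|/bk//] := eqVneq (val (k r0) q) 0.
  by rewrite mul0rz subr0 => /bf.
have gE : val g r0 = (val f r0 %% val (k r0) r0)%Z.
  rewrite /g direct_sum_valB valZ mulrzz /n {1}(divz_eq (val f r0) (val (k r0) r0)).
  by rewrite mulrC addrC addKr.
have Qg : Q g.
  apply: Q_lower => //; apply/eqP; apply: contraT => g0.
  have := kmin g Lg bg g0; rewrite gE leqNgt -ltz_nat !abszE.
  by rewrite (ger0_norm (modz_ge0 _ kr)) ltz_mod.
by rewrite -(subrK (k r0 *~ n) f); apply: QD => //; apply/QZ/Qk.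
Qed.

End IntegralVectors.

Section ClosureVectors.
Local Open Scope ring_scope.

(** The multiplicities of the relators in a product of their conjugates form one vector, which
    computes every conjugation-invariant character at once. *)
Lemma closure_vector (F : groupType) (R : set F) w : normal_closure R w ->
  exists f : int_vector F, (forall r, val f r != 0 -> R r) /\
    forall (B : zmodType) (phi : F -> B), closure_char (normal_closure R) phi ->
      phi w = pairing phi f.
Proof.
pose Q := [set w | normal_closure R w /\
  exists f : int_vector F, (forall r, val f r != 0 -> R r) /\
    forall (B : zmodType) (phi : F -> B), closure_char (normal_closure R) phi ->
      phi w = pairing phi f].
have NN := normal_closureP R; suff : normal_closure R `<=` Q by move=> RQ /RQ[].
apply: normal_closure_min => [|r Rr].
  split=> [|u v [Nu [f [fR fE]]] [Nv [g [gR gE]]]|u v [Nu [f [fR fE]]]].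
  - split; first exact: (normal_subgroup1 NN).
    exists 0; split=> [r|B phi phiN]; first by rewrite direct_sum_val0 eqxx.
    by rewrite raddf0; exact: (closure_char1 NN phiN).
  - have NvV := normal_subgroupV NN Nv; split; first exact: (normal_subgroupM NN).
    exists (f - g); split=> [r|B phi phiN].
      rewrite direct_sum_valB; have [->|/fR//] := eqVneq (val f r) 0.
      by rewrite sub0r oppr_eq0 => /gR.
    have [phiM _] := phiN; rewrite phiM // (closure_charV NN phiN) // raddfB /=.
    by rewrite fE // gE.
  - split; first by case: NN => _ _; exact.
    exists f; split=> // B phi phiN; rewrite -fE //; have [_ phiJ] := phiN.
    by rewrite conjgE mulgA -{2}[v]invgK; exact: phiJ.
split; first exact: sub_normal_closure.
exists (@single F (fun=> int : zmodType) r (1 : int)); split=> [q|B phi _]; last first.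
  by rewrite pairing_single.
have [<-//|rq] := pselect (r = q).
by rewrite [val _ q](@single_val_out _ (fun=> int : zmodType)) // eqxx.
Qed.

End ClosureVectors.

Section ModulePresentation.
Local Open Scope ring_scope.
Variables (m : nat) (G : 'I_m -> groupType) (K : scomplex m).
Variable Pr : presentation (Cart G K).
Notation F := (free_group (gens Pr)).
Notation N := (normal_closure (rels Pr)).
Hypothesis Kflag : flag K.

(** The kernel of the map from Z^(R) to the abelianization of the free group, tested on additive
    functions. *)
Definition relation_vector (f : int_vector F) : Prop :=
  (forall r, val f r != 0 -> rels Pr r) /\
  (forall (B : zmodType) (a : F -> B), additive_word a -> pairing a f = 0).

(** The relators of [module_words_exist] give vectors in [L], so triangular generators of [L] map to
    generators of the direct sum. The data [R] and [k] are kept for the linear algebra of the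
    deficiency. *)
Lemma module_presentation_exists :
  exists (R : rel F) (S : set F) (k : F -> int_vector F) (Q : presentation (M_group G K)),
  [/\ total R /\ antisymmetric R /\ transitive R,
      forall r, S r -> relation_vector (k r),
      forall r, S r -> val (k r) r != 0 /\ forall q, val (k r) q != 0 -> R q r &
      [set: gens Q] #= S].
Proof.
have [eps epsE] := @edge_words_exist m G K Pr.
have [psi psiP] := flux_family_exists Kflag epsE.
have wordsP := module_words_exist epsE psiP.
pose val_of (f : int_vector F) (x : M_module G K) :=
  forall i, pairing (psi i) f = homology_class (val x i).
(* The fluxes of an arbitrary relation vector are not known to come from the direct sum, so [L]
   demands it. *)
pose L := [set f | relation_vector f /\ exists x, val_of f x].
have val_inj f x y : val_of f x -> val_of f y -> x = y.
  move=> fx fy; apply: direct_sumP => i; apply: homology_class_inj.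
  by rewrite -fx -fy.
have val_B f g x y : val_of f x -> val_of g y -> val_of (f - g) (x - y).
  by move=> fx gy i; rewrite [LHS]raddfB /= fx gy -raddfB.
have val_0 : val_of 0 0 by move=> i; rewrite !raddf0.
have rel_B f g : relation_vector f -> relation_vector g -> relation_vector (f - g).
  move=> [fR fa] [gR ga]; split=> [r|B a aM]; last by rewrite raddfB /= fa // ga // subr0.
  rewrite direct_sum_valB; have [->|/fR//] := eqVneq (val f r) 0.
  by rewrite sub0r oppr_eq0 => /gR.
have [||R [S [k [Rord kL ktri kgen]]]] := @triangular_generators _ L.
- split; last by exists 0.
  by split=> [r|B a aM]; rewrite ?direct_sum_val0 ?eqxx ?raddf0.
- move=> f g [fr [x fx]] [gr [y gy]]; split; first exact: rel_B.
  by exists (x - y); exact: val_B.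
have xP r : exists x, S r -> val_of (k r) x.
  have [Sr|] := pselect (S r); last by exists 0.
  by have [_ [x kx]] := kL r Sr; exists x.
have [x xE] := choice xP.
pose g (r : S) : M_group G K := x (val r).
pose lift := free_lift g.
have liftM : {morph lift : u v / (u * v)%g} by exact: free_liftM.
have [Q QS] : exists Q : presentation (M_group G K), gens Q = S :> choiceType.
  apply: (presentation_of_gens (f := g)) => y.
  pose gen (f : int_vector F) := exists w, val_of f (lift w).
  have genL f : L f -> gen f.
    apply: kgen => [|f1 f2 [w1 f1w] [w2 f2w]|r Sr].
    - by exists 1%g; rewrite (morph_one liftM).
    - exists (w1 * w2^-1)%g; rewrite liftM (morph_inv liftM); exact: val_B.
    - exists (free_gen (SigSub (mem_set Sr) : S)); rewrite /lift free_lift_gen.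
      exact: xE.
  have [w [Nw aw psiw]] := wordsP y; have [f [fR fE]] := closure_vector Nw.
  have fy : val_of f y.
    by move=> i; rewrite -psiw -fE //; have [] := psiP i.
  have [|u fu] := genL f; last by exists u; exact: val_inj fu fy.
  split; last by exists y.
  by split=> // B a aM; rewrite -fE ?aw //; exact: additive_word_char.
exists R, S, k, Q; split=> //; first by move=> r /kL[].
rewrite QS; exact: card_setT.
Qed.

End ModulePresentation.

(** * Counting generators and relations *)

Section WordValues.
Local Open Scope ring_scope.
Variables (X : choiceType).

Definition word_value (lam : X -> rat) (w : free_group X) : rat :=
  free_lift (fun x => lam x : additive_group rat) w.

Lemma word_value_additive lam : additive_word (word_value lam).
Proof. by move=> u v; exact: (free_liftM (H := additive_group rat)). Qed.

Lemma word_value_gen lam x : word_value lam (free_gen x) = lam x.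
Proof. exact: (free_lift_gen (H := additive_group rat)). Qed.

Lemma word_value_linear w a lam mu :
  word_value (fun x => a * lam x + mu x) w = a * word_value lam w + word_value mu w.
Proof.
have M := word_value_additive; elim/free_ind: w => [|x w IH|x w IH].
- by rewrite !additive_word1 // mulr0 addr0.
- by rewrite !M IH !word_value_gen mulrDr addrACA.
- by rewrite !M IH !additive_wordV // !word_value_gen opprD mulrDr mulrN addrACA.
Qed.

End WordValues.

(** * Linear algebra of a presentation with finitely many relators *)

Section FiniteRank.
Local Open Scope ring_scope.

Definition functional (X : Type) (l : (X -> rat) -> rat) : Prop :=
  forall a lam mu, l (fun x => a * lam x + mu x) = a * l lam + l mu.

Variables (X : choiceType) (rels : set (free_group X)) (S : set (free_group X)).
Variables (R : rel (free_group X)) (k : free_group X -> int_vector (free_group X)).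
Hypotheses (Rtot : total R) (Ranti : antisymmetric R) (Rtr : transitive R).
Hypothesis kR : forall r, S r -> forall q, val (k r) q != 0 -> rels q.
Hypothesis ka : forall r, S r ->
  forall (B : zmodType) (a : free_group X -> B), additive_word a -> pairing a (k r) = 0.
Hypothesis ktri : forall r, S r ->
  val (k r) r != 0 /\ forall q, val (k r) q != 0 -> R q r.
Variables (n : nat) (l : 'I_n -> (X -> rat) -> rat).
Hypothesis l_lin : forall i, functional (l i).
Hypothesis l_inj : forall lam : X -> rat,
  (forall r, rels r -> word_value lam r = 0) -> (forall i, l i lam = 0) -> forall x, lam x = 0.

Lemma functional_sum (g : (X -> rat) -> rat) (s : seq X) (c : X -> rat) :
  functional g ->
  g (fun x => \sum_(y <- s) c y * (x == y)%:R) = \sum_(y <- s) c y * g (fun x => (x == y)%:R).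
Proof.
move=> gl; elim: s => [|y s IH].
  rewrite big_nil; have -> : (fun x => \sum_(y <- [::]) c y * (x == y)%:R) = (fun=> 0 : rat).
    by apply/funext => x; rewrite big_nil.
  have -> : (fun=> 0 : rat) = (fun x : X => -1 * 0 + 0) by apply/funext => x; rewrite mulr0 addr0.
  by rewrite (gl (-1) (fun=> 0) (fun=> 0)) mulN1r addNr.
rewrite big_cons -IH -gl; congr g; apply/funext => x; by rewrite big_cons.
Qed.

Variable rs : seq (free_group X).
Hypotheses (rs_uniq : uniq rs) (rsE : forall r, rels r <-> r \in rs).

(** A linear relation between the rows of the exponent sums [A], extended by the values [B] of the
    functionals, is a character that kills the relators and all [l i], hence zero. So the extended
    matrix has full row rank. *)
Lemma gens_rank_bound (s : seq X) : uniq s ->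
  exists A : 'M[rat]_(size s, size rs),
    (size s <= \rank A + n)%N /\
    forall i j, A i j = word_value (fun x => (x == tnth (in_tuple s) i)%:R) (tnth (in_tuple rs) j).
Proof.
move=> us.
pose A : 'M[rat]_(size s, size rs) := \matrix_(i, j)
  word_value (fun x => (x == tnth (in_tuple s) i)%:R) (tnth (in_tuple rs) j).
pose B : 'M[rat]_(size s, n) := \matrix_(i, j)
  l j (fun x => (x == tnth (in_tuple s) i)%:R).
exists A; split; last by move=> i j; rewrite mxE.
have : row_free (row_mx A B).
  apply: inj_row_free => v vAB.
  have [vA vB] : v *m A = 0 /\ v *m B = 0.
    by move: vAB; rewrite mul_mx_row -[X in _ = X]row_mx0 => /eq_row_mx.
  pose c x := if insub (index x s) is Some i then v 0 i else 0.
  have cE i : c (tnth (in_tuple s) i) = v 0 i.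
    rewrite /c (tnth_nth (tnth (in_tuple s) i)) /= index_uniq // ?insubT ?ltn_ord //.
    by move=> H; congr (v 0 _); apply: val_inj.
  pose lam x := \sum_(y <- s) c y * (x == y)%:R.
  have lamE (g : (X -> rat) -> rat) : functional g ->
      g lam = \sum_i v 0 i * g (fun x => (x == tnth (in_tuple s) i)%:R).
    move=> gl; rewrite (functional_sum _ _ gl) big_tnth.
    by apply: eq_bigr => i _; rewrite cE.
  have lam0 x : lam x = 0.
    apply: l_inj => [r /rsE rr|i].
      rewrite (lamE (fun mu => word_value mu r)); last by move=> a f g; exact: word_value_linear.
      have /tnthP[j ->] : r \in in_tuple rs by [].
      have vAj : (v *m A) 0 j = 0 by rewrite vA mxE.
      rewrite -[RHS]vAj mxE.
      by apply: eq_bigr => i _; rewrite mxE.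
    rewrite lamE //.
    have vBi : (v *m B) 0 i = 0 by rewrite vB mxE.
    rewrite -[RHS]vBi mxE.
    by apply: eq_bigr => j _; rewrite mxE.
  apply/rowP => i; rewrite mxE -(lam0 (tnth (in_tuple s) i)) /lam -cE.
  rewrite (bigD1_seq (tnth (in_tuple s) i)) ?mem_tnth //= eqxx mulr1 big1 ?addr0 // => y.
  by rewrite eq_sym => /negPf->; rewrite mulr0.
rewrite /row_free => /eqP{1}<-; rewrite -mxrank_tr tr_row_mx -addsmxE.
rewrite (leq_trans (mxrank_adds_leqif _ _)) // !mxrank_tr leq_add2l rank_leq_col //.
Qed.

(** Zero exponent sums make the rows of [C] orthogonal to those of [A], and triangularity makes them
    independent, so the two ranks add up to at most the number of relators. *)
Lemma triangular_rank_bound (ss : seq (free_group X)) (d : nat)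
    (A : 'M[rat]_(d, size rs)) (lam : 'I_d -> X -> rat) :
  uniq ss -> (forall r, r \in ss -> S r) ->
  (forall i j, A i j = word_value (lam i) (tnth (in_tuple rs) j)) ->
  (size ss + \rank A <= size rs)%N.
Proof.
move=> uss ssS AE.
pose C : 'M[rat]_(size ss, size rs) := \matrix_(i, j)
  (val (k (tnth (in_tuple ss) i)) (tnth (in_tuple rs) j) : int)%:~R.
have tS i : S (tnth (in_tuple ss) i) by apply: ssS; exact: mem_tnth.
have CA : C *m A^T = 0.
  apply/matrixP => a i; rewrite !mxE.
  rewrite -[RHS](ka (tS a) (word_value_additive (lam i))).
  rewrite (pairingE _ rs_uniq) => [|r /(kR (tS a)) /rsE //].
  by rewrite [RHS]big_tnth; apply: eq_bigr => j _; rewrite !mxE AE mulrC mulrzr.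
have Cfree : row_free C.
  apply: inj_row_free => v vC; apply/eqP; apply: contraT => v0.
  (* At the greatest relator with a nonzero coefficient in [v], only one term of the combination
     survives. *)
  pose nz := [seq tnth (in_tuple ss) i | i <- enum 'I_(size ss) & v 0 i != 0].
  have [|r /mapP[i]] := @total_order_max _ R nz Rtot Rtr.
    apply: contraNneq v0 => nz0; apply/eqP/rowP => i; rewrite mxE; apply/eqP.
    apply: contraT => vi; have : tnth (in_tuple ss) i \in nz.
      by apply: map_f; rewrite mem_filter vi mem_enum.
    by rewrite nz0.
  rewrite mem_filter => /andP[vi _] rE rmax; rewrite {r}rE in rmax.
  have [ki kiR] := ktri (tS i).
  have /rsE/(@tnthP _ _ (in_tuple rs))[j jE] : rels (tnth (in_tuple ss) i) by exact: kR ki.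
  have vCj : (v *m C) 0 j = 0 by rewrite vC mxE.
  move: vCj; rewrite mxE (bigD1 i) //= big1 => [|i' i'i].
    rewrite addr0 mxE -jE => /eqP; rewrite mulf_eq0 (negPf vi) intr_eq0.
    by rewrite (negPf ki).
  rewrite mxE -jE; have [->|vi'] := eqVneq (v 0 i') 0; first by rewrite mul0r.
  have [->|ki'] := eqVneq (val (k (tnth (in_tuple ss) i')) (tnth (in_tuple ss) i)) 0.
    by rewrite mulr0.
  have Rii' : R (tnth (in_tuple ss) i) (tnth (in_tuple ss) i').
    by have [_] := ktri (tS i'); exact.
  have Ri'i : R (tnth (in_tuple ss) i') (tnth (in_tuple ss) i).
    by apply: rmax; apply: map_f; rewrite mem_filter vi' mem_enum.
  have tinj : injective (tnth (in_tuple ss)) by exact/tuple_uniqP.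
  have /tinj/eqP : tnth (in_tuple ss) i = tnth (in_tuple ss) i' by apply: Ranti; rewrite Rii' Ri'i.
  by rewrite eq_sym (negPf i'i).
by have := mulmx0_rank_max CA; rewrite mxrank_tr (eqP Cfree).
Qed.

(** The first bound limits every list of distinct generators, so a longest one contains them all;
    combining it with the second bound eliminates the rank of [A]. *)
Lemma gens_finite : exists2 xs : seq X, uniq xs /\ (forall x, x \in xs) &
  forall ss : seq (free_group X), uniq ss -> (forall r, r \in ss -> S r) ->
    (size ss + size xs <= size rs + n)%N.
Proof.
pose p d := `[< exists2 s : seq X, uniq s & size s = d >].
have p0 : exists d, p d by exists 0%N; apply/asboolP; exists [::].
have pmax d : p d -> (d <= size rs + n)%N.
  move=> /asboolP[s us <-]; have [A [sA _]] := gens_rank_bound us.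
  by rewrite (leq_trans sA) // leq_add2r rank_leq_col.
have [_ /asboolP[xs uxs <-] xsmax] := ex_maxnP p0 pmax.
exists xs => [|ss uss ssS].
  split=> // x; apply: contraT => xxs.
  have /xsmax : p (size (x :: xs)) by apply/asboolP; exists (x :: xs); rewrite //= xxs.
  by rewrite ltnn.
have [A [xsA AE]] := gens_rank_bound uxs.
have := triangular_rank_bound uss ssS AE.
rewrite -(leq_add2r n) => /(leq_trans _); apply.
by rewrite -addnA leq_add2l.
Qed.

End FiniteRank.

(** * Locally constant functions on a complex *)

Section ConnectedComponents.
Local Open Scope ring_scope.
Variables (m : nat) (D : {set {set 'I_m}}).

(** The chains [zs] represent a basis of the reduced homology in degree 0. A locally constant
    function orthogonal to them vanishes on every reduced cycle, in particular on the difference of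
    two vertices. *)
Lemma locally_constant_eq : exists zs : 'I_(reduced_betti0 D) -> chain rat m,
  forall U : 'I_m -> rat, (forall i j, [set i; j]%SET \in D -> U i = U j) ->
    (forall l, \sum_i zs l [set i]%SET * U i = 0) ->
    forall i j, [set i]%SET \in D -> [set j]%SET \in D -> U i = U j.
Proof.
have [[f flin [g fg gf]]] := reduced_betti0P D.
pose V := quotient_module (in_boundaries_closed rat D 1).
exists (fun l => val (repr (g (delta_mx 0 l) : V))) => U Uedge Uz i j iD jD.
pose h (z : Defs.cycle rat D 1) : rat := \sum_i val z [set i]%SET * U i.
have hlin a x y : h (a *: x + y) = a * h x + h y.
  rewrite /h mulr_sumr -big_split; apply: eq_bigr => k _ /=.
  by rewrite !ffunE mulrDl -mulrA.
have hB x y : h (x - y) = h x - h y.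
  by rewrite addrC -scaleN1r hlin mulN1r addrC.
have h_bound z : in_boundaries z -> h z = 0.
  move=> /asboolP[c cD cz]; rewrite /h -cz.
  under eq_bigr => k _ do rewrite (boundary_edges k cD) mulr_suml.
  rewrite exchange_big big1 //= => -[u v] uv /=.
  have [->|/(in_chains_supp cD)[/Uedge Uuv _]] := eqVneq (c [set u; v]%SET) 0.
    by rewrite big1 // => k _; rewrite mul0r mul0r.
  under eq_bigr => k _ do rewrite -mulrA.
  have sumE w : \sum_k (k == w)%:R * U k = U w.
    by rewrite (bigD1 w) //= eqxx mul1r big1 ?addr0 // => k /negPf->; rewrite mul0r.
  under eq_bigr => k _ do rewrite mulrBl.
  by rewrite -mulr_sumr sumrB !sumE Uuv subrr mulr0.
have h_repr z : h (repr (cycle_class z)) = h z.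
  apply/eqP; rewrite -subr_eq0 -hB; apply/eqP/h_bound/cycle_class_eq; exact: reprK.
pose hg (r : 'rV[rat]_(reduced_betti0 D)) := h (repr (g r : V)).
have hglin a r s : hg (a *: r + s) = a * hg r + hg s.
  rewrite /hg; have -> : g (a *: r + s) = a *: (g r : V) + (g s : V).
    by apply: (can_inj fg); rewrite flin !gf.
  have [[x <-] [y <-]] := (cycle_class_surj (g r : V), cycle_class_surj (g s : V)).
  have -> : a *: cycle_class x + cycle_class y = cycle_class (a *: x + y).
    by rewrite /cycle_class -quo_addr_pi -quo_scale_pi.
  by rewrite !h_repr hlin.
have hg0 : hg 0 = 0.
  by have := hglin (-1) 0 0; rewrite scaler0 addr0 mulN1r addNr.
have hgE r : hg r = 0.
  rewrite (row_sum_delta r); elim/big_rec: _ => // l s _ IH.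
  by rewrite hglin IH addr0 /hg [h _]Uz mulr0.
have hz z : h z = 0.
  by rewrite -h_repr; have := hgE (f (cycle_class z)); rewrite /hg fg.
have [->//|ij] := eqVneq i j.
pose c : chain rat m := chain_of rat [set i]%SET - chain_of rat [set j]%SET.
have bd1 w : boundary (chain_of rat [set w]%SET) = chain_of rat finset.set0.
  rewrite boundary_chain_of big_set1 finset.setDv.
  have -> : [set u in [set w]%SET | (u < w)%N]%SET = finset.set0.
    by apply/setP => u; rewrite !inE; case: eqVneq => // ->; rewrite ltnn.
  by rewrite cards0 expr0 scale1r.
have cD : in_cycles D 1 c.
  apply/andP; split; last by rewrite linearB /= !bd1 subrr.
  apply/forallP => s; apply/implyP; rewrite !ffunE.
  have [->|si] := eqVneq s [set i]%SET; first by rewrite iD cards1.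
  have [->|sj] := eqVneq s [set j]%SET; first by rewrite jD cards1.
  by rewrite subrr eqxx.
have := hz (MkCycle cD); rewrite /h /= => cU; apply/eqP; rewrite -subr_eq0 -{}cU.
apply/eqP; have sumE w : \sum_k (k == w)%:R * U k = U w.
  by rewrite (bigD1 w) //= eqxx mul1r big1 ?addr0 // => k /negPf->; rewrite mul0r.
rewrite -[U i]sumE -[U j in LHS]sumE -sumrB; apply: eq_bigr => k _.
by rewrite !ffunE !(inj_eq finset.set1_inj) -mulrBl.
Qed.

End ConnectedComponents.

(** * First rational homology *)

Section FirstHomology.
Local Open Scope ring_scope.
Variables (m : nat) (G : 'I_m -> groupType) (K : scomplex m).
Notation GP := (graph_product G K).
Notation P := (prod_group G).
Notation "g :>> x" := (g * graph_product_in K x)%g (at level 40, left associativity).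
Notation "p :-> x" := (p * prod_in x)%g (at level 40, left associativity).
Notation pr := (@graph_product_proj m G K).
Notation edge i j := ([set i; j]%SET \in faces K).
Variable Pr : presentation (Cart G K).
Notation F := (free_group (gens Pr)).
Notation N := (normal_closure (rels Pr)).
Notation s := (@ordered_section m G K).
Variable eps : P -> forall i, G i -> F.
Hypothesis epsE : forall p i (x : G i),
  cart_proj (eps p x) = (s p :>> x * (s (p :-> x))^-1)%g.
Variables (B : zmodType) (a : F -> B).
Hypotheses (aM : additive_word a) (aR : forall r, rels Pr r -> a r = 0).

Lemma additive_closure w : N w -> a w = 0.
Proof.
apply: (normal_closure_min (N := [set w | a w = 0])) => //.
split=> /= [|u v u0 v0|u v u0]; first exact: additive_word1.
  by rewrite aM (additive_wordV aM) u0 v0 subr0.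
by rewrite conjgE !aM (additive_wordV aM) u0 add0r addNr.
Qed.

Lemma additive_cart_eq u v : cart_proj u = cart_proj v -> a u = a v.
Proof.
move=> uv; apply/eqP; rewrite -subr_eq0 -(additive_wordV aM) -aM; apply/eqP.
apply/additive_closure/cart_proj_eq1; rewrite cart_projM uv.
by rewrite (morph_inv (@cart_projM _ _ _ Pr)) mulgV.
Qed.

Definition vertex_potential (J : {set 'I_m}) (t : P) (i : 'I_m) : B :=
  alternating_sum J t (fun p i (x : G i) => a (eps p x)) i.

(** The cube word on [i] and [j] is killed by [a], and its value is the difference of the two
    potentials. *)
Lemma vertex_potential_edge (J : {set 'I_m}) (t : P) i j : i \in J -> j \in J -> edge i j ->
  vertex_potential J t i = vertex_potential J t j.
Proof.
move=> iJ jJ ijK; have [->//|ij] := eqVneq i j.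
have t1 k : k \in finset.set0 -> t k != 1%g by rewrite inE.
have [Nw] := cube_word_char t (normal_closureP (rels Pr)) (square_in_closure epsE)
  (additive_word_char aM N) (additive_word_law eps aM finset.set0 t) t1 iJ jJ ij ijK.
rewrite additive_closure // mul0rz add0r => /esym/eqP; rewrite subr_eq0.
by move=> /eqP.
Qed.

(* The ordered section makes the edges in the direction of the last vertex trivial,
   which normalizes the locally constant function [vertex_potential]. *)
Lemma vertex_potential_last (J : {set 'I_m}) (t : P) (i : 'I_m) :
  (forall k : 'I_m, k \in J -> (k <= i)%N) ->
  vertex_potential J t i = 0.
Proof.
move=> imax; rewrite /vertex_potential /alternating_sum big1 // => I.
rewrite powersetE subsetD1 => /andP[IJ iI].
rewrite additive_closure ?mul0rz //; apply/cart_proj_eq1; rewrite epsE.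
rewrite ordered_section_step ?mulgV // => k ik; rewrite /restr; case: ifP => // kI.
have ki := imax _ (fintype.subsetP IJ _ kI).
by move: iI; rewrite (_ : i = k) ?kI //; apply/val_inj/eqP; rewrite eqn_leq ik ki.
Qed.

Hypothesis vertex0 : forall (J : {set 'I_m}) (t : P), (forall k, k \in J -> t k != 1%g) ->
  forall i, i \in J -> vertex_potential J t i = 0.

(* Moebius inversion: [vertex0] on all the subsets of [i |: I] recovers the values on
   the single edges. *)
Lemma restr_edge0 (t : P) (I : {set 'I_m}) i : i \notin I ->
  (forall k, k \in (i |: I)%SET -> t k != 1%g) -> a (eps (restr t I) (t i)) = 0.
Proof.
have [n] := ubnP #|I|; elim: n I => // n IH I In iI t1.
have := vertex0 t1 (setU11 i I); rewrite /vertex_potential /alternating_sum setU1K //.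
rewrite (bigD1 I) ?powersetE //= big1 => [|I' /andP[]]; last first.
  rewrite powersetE => sI nI; rewrite IH ?mul0rz //.
  - have : (#|I'| < #|I|)%N by apply: proper_card; rewrite finset.properEneq nI.
    by move=> /leq_trans; apply.
  - by apply: contraNN iI; exact/fintype.subsetP.
  - move=> k; rewrite inE => /orP[ki|kI']; apply: t1; rewrite inE ?ki //.
    by rewrite (fintype.subsetP sI) ?orbT.
rewrite addr0 /cube_sign => H; rewrite -[LHS]mulr1z -(sqrr_sign int #|(i |: I) :\: I|)
  expr2 mulrzA H mul0rz //.
Qed.

(** An edge from a point whose coordinate [i] is 1 lies in some cube, which [restr_edge0] treats.
    Any other edge is the difference of two of these, as its starting point is itself reached along
    direction [i]. *)
Lemma edge0 (p : P) i (x : G i) : a (eps p x) = 0.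
Proof.
have base (q : P) (y : G i) : q i = 1%g -> a (eps q y) = 0.
  move=> qi; have [->|y1] := eqVneq y 1%g.
    apply/additive_closure/cart_proj_eq1; rewrite epsE graph_product_in1 mulg1.
    have -> : (q :-> (1 : G i) = q)%g; last by rewrite mulgV.
    apply: functional_extensionality_dep => k; have [->|ki] := eqVneq k i.
      by rewrite prod_mul_in mulg1.
    by rewrite prod_mul_in_out.
  pose t : P := (q :-> y)%g; pose I := [set k | (k != i) && (q k != 1%g)]%SET.
  have ti : t i = y by rewrite /t prod_mul_in qi mul1g.
  have iI : i \notin I by rewrite inE eqxx.
  have qE : restr t I = q.
    apply: functional_extensionality_dep => k; rewrite /restr inE.
    have [->|ki] := eqVneq k i; first by rewrite qi.
    by rewrite /t prod_mul_in_out //=; case: eqVneq.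
  have := @restr_edge0 t I i iI; rewrite qE ti; apply=> k.
  rewrite !inE; have [->|ki] /= := eqVneq k i; first by rewrite ti.
  by rewrite /t prod_mul_in_out.
pose q : P := fun k => if k == i then 1%g else p k.
have qi : q i = 1%g by rewrite /q eqxx.
have qp : (q :-> p i = p)%g.
  apply: functional_extensionality_dep => k; have [->|ki] := eqVneq k i.
    by rewrite prod_mul_in qi mul1g.
  by rewrite prod_mul_in_out // /q (negPf ki).
rewrite (@additive_cart_eq _ ((eps q (p i))^-1 * eps q (p i * x))%g).
  by rewrite aM (additive_wordV aM) !base // addr0 oppr0.
rewrite cart_projM (morph_inv (@cart_projM _ _ _ Pr)) !epsE qp.
have -> : (q :-> (p i * x) = p :-> x)%g by rewrite prod_inM mulgA qp.
by rewrite graph_product_inM !invgM invgK !mulgA !mulgVK.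
Qed.

(** Reidemeister-Schreier rewriting: along the letters of its image, a word becomes a product of
    edge words, on each of which [a] vanishes. *)
Lemma additive_eq0 w : a w = 0.
Proof.
have H g : forall p w, cart_proj w = (s p * g * (s (p * pr g))^-1)%g -> a w = 0.
  elim/graph_product_ind: g => [|g i x IH] p v vE.
    apply/additive_closure/cart_proj_eq1.
    by rewrite vE (morph_one (@graph_product_projM _ _ _)) !mulg1 mulgV.
  have [u uE] : exists u : F, cart_proj u = (s (p :-> x) * g * (s (p :-> x * pr g))^-1)%g.
    apply: cart_proj_surj.
    rewrite !graph_product_projM (morph_inv (@graph_product_projM _ _ _)).
    by rewrite !graph_product_proj_ordered mulgV.
  rewrite (@additive_cart_eq _ (eps p x * u)%g); first by rewrite aM edge0 (IH _ _ uE) addr0.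
  rewrite cart_projM vE epsE uE graph_product_projM graph_product_proj_in !mulgA.
  by rewrite mulgVK.
apply: (H (cart_proj w) 1%g); rewrite mul1g proj_cart_proj.
have -> : s 1%g = 1%g.
  by rewrite /ordered_section big1_seq // => k _; exact: graph_product_in1.
by rewrite invg1 mulg1 mul1g.
Qed.

End FirstHomology.

Section FirstHomologyBound.
Local Open Scope ring_scope.
Variables (m : nat) (G : 'I_m -> groupType) (K : scomplex m).
Notation P := (prod_group G).
Notation edge i j := ([set i; j]%SET \in faces K).
Variable Pr : presentation (Cart G K).
Notation X := (gens Pr).
Notation b J := (reduced_betti0 (full_subcomplex K J)).

Variable reps : {set 'I_m} -> seq P.
Hypothesis repsP : forall (J : {set 'I_m}) (t : P), (forall k, k \in J -> t k != 1%g) ->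
  b J = 0%N \/ exists2 t', t' \in reps J & forall k, k \in J -> t k = t' k.

(** Each [J], representative tuple and basis class in degree 0 gives one functional, the pairing of
    the class with [vertex_potential]. If all vanish, the potential is constant on [J], hence zero
    by its value at the last vertex. Where [b J = 0] it is constant for every tuple, even if there
    are infinitely many. *)
Lemma first_homology_functionals :
  exists l : 'I_(\sum_J size (reps J) * b J)%N -> (X -> rat) -> rat,
  (forall i, functional (l i)) /\
  forall lam : X -> rat, (forall r, rels Pr r -> word_value lam r = 0) ->
    (forall i, l i lam = 0) -> forall x, lam x = 0.
Proof.
have [eps epsE] := @edge_words_exist m G K Pr.
pose zs J := sval (cid (locally_constant_eq (full_subcomplex K J))).
have zsP J := svalP (cid (locally_constant_eq (full_subcomplex K J))); rewrite -/(zs _) in zsP.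
pose U (J : {set 'I_m}) (t : P) (lam : X -> rat) i : rat :=
  if i \in J then vertex_potential eps (word_value lam) J t i else 0.
pose E := {J : {set 'I_m} & (P * 'I_(b J))%type}.
pose es : seq E := flatten [seq [seq Tagged (fun J => (P * 'I_(b J))%type) (t, l) |
  t <- reps J, l <- enum 'I_(b J)] | J <- enum {set 'I_m}].
have esz : size es = (\sum_J size (reps J) * b J)%N.
  rewrite size_flatten /shape -map_comp sumnE big_map big_enum /=.
  by apply: eq_bigr => J _; rewrite size_allpairs size_enum_ord.
pose g (e : E) (lam : X -> rat) : rat :=
  \sum_i zs (tag e) (tagged e).2 [set i]%SET * U (tag e) (tagged e).1 lam i.
have Ulin J t i : functional (fun lam => U J t lam i).
  move=> a lam mu; rewrite /U; case: ifP => _; last by rewrite mulr0 addr0.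
  rewrite /vertex_potential /alternating_sum mulr_sumr -big_split; apply: eq_bigr => I _ /=.
  by rewrite word_value_linear mulrzDl mulrzAr.
rewrite -esz; exists (fun i => g (tnth (in_tuple es) i)); split=> [i a lam mu|lam lamR lamg x].
  rewrite /g mulr_sumr -big_split; apply: eq_bigr => k _ /=.
  by rewrite Ulin mulrDr mulrCA.
rewrite -[LHS]word_value_gen; have aM := word_value_additive lam.
apply: (additive_eq0 epsE aM lamR) => J t t1 i iJ.
have Uedge t' u v : [set u; v]%SET \in full_subcomplex K J -> U J t' lam u = U J t' lam v.
  rewrite inE => /andP[uvK uvJ].
  have uJ : u \in J by apply: (fintype.subsetP uvJ); rewrite !inE eqxx.
  have vJ : v \in J by apply: (fintype.subsetP uvJ); rewrite !inE eqxx orbT.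
  by rewrite /U uJ vJ; exact: (vertex_potential_edge epsE aM lamR).
have vK w : w \in J -> [set w]%SET \in full_subcomplex K J.
  by move=> wJ; rewrite inE face1 finset.sub1set.
have [j jJ jmax] : exists2 j, j \in J & forall k : 'I_m, k \in J -> (k <= j)%N.
  by case: (arg_maxnP (P := mem J) val iJ) => j jJ jmax; exists j.
suff: U J t lam i = U J t lam j.
  by rewrite /U iJ jJ => ->; exact: (vertex_potential_last epsE aM lamR).
have [b0|[t' t'J tt']] := repsP t1.
  apply: zsP => [u v|l||]; [exact: Uedge| |exact: vK|exact: vK].
  by have := ltn_ord l; rewrite [X in (_ < X)%N]b0.
have UE w : U J t lam w = U J t' lam w.
  rewrite /U; case: ifP => // wJ; rewrite /vertex_potential /alternating_sum tt' //.
  apply: eq_bigr => I; rewrite powersetE subsetD1 => /andP[IJ _].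
  suff -> : restr t I = restr t' I by [].
  apply: functional_extensionality_dep => k; rewrite /restr; case: ifP => // kI.
  by rewrite tt' // (fintype.subsetP IJ).
rewrite !UE; apply: zsP => [u v|l||]; [exact: Uedge| |exact: vK|exact: vK].
have eJ : (Tagged (fun J => (P * 'I_(b J))%type) (t', l) : E) \in es.
  apply/flatten_mapP; exists J; first by rewrite mem_enum.
  by apply/allpairsP; exists (t', l); rewrite mem_enum.
have /tnthP[k kE] : (Tagged (fun J => (P * 'I_(b J))%type) (t', l) : E) \in in_tuple es by [].
by have := lamg k; rewrite -kE.
Qed.

End FirstHomologyBound.

(** * Extended real counts and the two bounds *)

Section Counting.
Local Open Scope ereal_scope.
Variable R : realType.

Lemma counting_seq (T : choiceType) (A : set T) (s : seq T) :
  uniq s -> (forall x, A x <-> x \in s) -> counting A = (size s)%:R%:E :> \bar R.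
Proof.
move=> us As; have -> : A = [set` s] by apply/seteqP; split=> x /As.
rewrite /counting asboolT; last exact: finite_seq.
congr (_%:R%:E); apply: perm_size; apply: uniq_perm => // x.
by rewrite in_fset_set; [apply/idP/idP => [/set_mem//|]; exact: mem_set|exact: finite_seq].
Qed.

Lemma finite_set_seq (T : choiceType) (A : set T) : finite_set A ->
  exists2 s : seq T, uniq s & forall x, A x <-> x \in s.
Proof.
move=> /finite_seqP[s ->]; exists (undup s); first exact: undup_uniq.
by move=> x; rewrite mem_undup.
Qed.

Lemma counting_infinite (T : choiceType) (A : set T) :
  infinite_set A -> counting A = +oo :> \bar R.
Proof. by move=> Ai; rewrite /counting asboolF. Qed.

Lemma counting_ge0 (T : choiceType) (A : set T) : 0 <= counting A :> \bar R.
Proof. by rewrite /counting; case: ifP => _ //; rewrite lee_fin. Qed.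

Lemma counting_le (T U : choiceType) (A : set T) (B : set U) :
  A #<= B -> counting A <= counting B :> \bar R.
Proof.
move=> AB; have [Bf|/counting_infinite->] := pselect (finite_set B); last exact: leey.
have Af := card_le_finite AB Bf.
rewrite /counting !asboolT // lee_fin ler_nat.
have [/finite_setP[i Ai] /finite_setP[j Bj]] := (Af, Bf).
rewrite (card_fset_set Ai) (card_fset_set Bj) -card_le_II.
by rewrite -(card_le_eql Ai) -(card_le_eqr Bj).
Qed.

End Counting.

Section TupleCovers.
Local Open Scope ereal_scope.
Variables (R : realType) (m : nat) (G : 'I_m -> groupType).
Notation P := (prod_group G).

(** The convention [0 * +oo = 0] matches the sets: if one factor is empty, there are no tuples and
    the empty list covers them. *)
Lemma tuple_cover (J : {set 'I_m}) :
  n_ G R J = +oo \/ exists2 reps : seq P, n_ G R J = (size reps)%:R%:E &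
    forall t : P, (forall k, k \in J -> t k != 1%g) ->
      exists2 t', t' \in reps & forall k, k \in J -> t k = t' k.
Proof.
pose c j : \bar R := counting [set g : G j | g != 1%g].
rewrite /n_; suff H (l : seq 'I_m) : uniq l ->
    \prod_(j <- l) c j = +oo \/
    exists2 reps : seq P, \prod_(j <- l) c j = (size reps)%:R%:E &
      forall t : P, (forall k, k \in l -> t k != 1%g) ->
        exists2 t', t' \in reps & forall k, k \in l -> t k = t' k.
  have [] := H (enum J) (enum_uniq _); rewrite big_enum /=; [by left|move=> [reps sz repsP]].
  right; exists reps => // t tJ; have [k|t' t'r tt'] := repsP t.
    by rewrite mem_enum; exact: tJ.
  by exists t' => // k kJ; apply: tt'; rewrite mem_enum.
elim: l => [_|j l IH /= /andP[jl ul]].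
  right; exists [:: 1%g : P]; first by rewrite big_nil.
  by move=> t _; exists 1%g => //; rewrite mem_head.
rewrite big_cons.
have none (A : \bar R) : (forall t : P, (forall k, k \in j :: l -> t k != 1%g) -> False) ->
    A = 0 -> A = +oo \/ exists2 reps : seq P, A = (size reps)%:R%:E &
      forall t : P, (forall k, k \in j :: l -> t k != 1%g) ->
        exists2 t', t' \in reps & forall k, k \in j :: l -> t k = t' k.
  by move=> nt ->; right; exists [::] => // t /nt.
have [gf|/(counting_infinite R)] := pselect (finite_set [set g : G j | g != 1%g]); last first.
  rewrite -/(c j) => ->; have [->|[reps -> repsP]] := IH ul; first by rewrite mulyy; left.
  case: reps repsP => [|p reps] repsP.
    apply: none; last by rewrite mule0.
    by move=> t tl; have [k kl|t'] := repsP t; [apply: tl; rewrite inE kl orbT|rewrite in_nil].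
  by left; rewrite gt0_mulye // lte_fin.
have [gs ugs gsP] := finite_set_seq gf; have cE : c j = (size gs)%:R%:E by exact: counting_seq.
have [->|[reps -> repsP]] := IH ul.
  rewrite cE; case: gs {ugs cE} gsP => [|g gs] gsP.
    apply: none; last by rewrite mul0e.
    by move=> t tl; have /gsP := tl j (mem_head _ _); rewrite in_nil.
  by left; rewrite gt0_muley // lte_fin.
right; exists [seq (eqtype.dfwith t' g : P) | g <- gs, t' <- reps].
  by rewrite cE size_allpairs natrM EFinM.
move=> t tl; have [k kl|t' t'r tt'] := repsP t; first by apply: tl; rewrite inE kl orbT.
exists (eqtype.dfwith t' (t j)).
  apply/allpairsP; exists (t j, t') => /=; split=> //.
  by apply/gsP; apply: tl; exact: mem_head.
move=> k; rewrite inE; have [->|kj /= kl] := eqVneq k j; first by rewrite dfwith_in.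
by rewrite dfwith_out 1?eq_sym // tt'.
Qed.

End TupleCovers.

Section Bounds.
Local Open Scope ereal_scope.
Variables (R : realType) (m : nat) (K : scomplex m) (G : 'I_m -> groupType).
Notation P := (prod_group G).
Notation b J := (reduced_betti0 (full_subcomplex K J)).

Lemma n_ge0 (J : {set 'I_m}) : 0 <= n_ G R J.
Proof.
by rewrite /n_; elim/big_ind: _ => // [x y|j _]; [exact: mule_ge0|exact: counting_ge0].
Qed.

(** All terms are nonnegative, so a finite sum allows an infinite [n_ G R J] only where the Betti
    number is 0. *)
Lemma tuple_covers : N_ G K R != +oo -> exists2 reps : {set 'I_m} -> seq P,
  (\sum_J size (reps J) * b J)%N%:R%:E = N_ G K R &
  forall (J : {set 'I_m}) (t : P), (forall k, k \in J -> t k != 1%g) ->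
    b J = 0%N \/ exists2 t', t' \in reps J & forall k, k \in J -> t k = t' k.
Proof.
move=> Nfin.
have term_ge0 J : 0 <= n_ G R J * (b J)%:R%:E.
  by apply: mule_ge0; [exact: n_ge0|rewrite lee_fin].
have H (J : {set 'I_m}) : exists reps : seq P,
    (size reps * b J)%:R%:E = n_ G R J * (b J)%:R%:E :> \bar R /\
    forall t : P, (forall k, k \in J -> t k != 1%g) ->
      b J = 0%N \/ exists2 t', t' \in reps & forall k, k \in J -> t k = t' k.
  have [b0|b0] := posnP (b J).
    by exists [::]; rewrite b0 mule0 mul0n; split=> // t _; left.
  have [nJ|[reps -> repsP]] := tuple_cover R G J.
    have NJ : N_ G K R = +oo; last by rewrite NJ eqxx in Nfin.
    apply/eqP; rewrite -leye_eq /N_ (bigD1 J) //= nJ gt0_mulye ?lte_fin ?ltr0n //.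
    by rewrite addye // gt_eqF // (lt_le_trans ltNy0) // sume_ge0.
  by exists reps; rewrite natrM EFinM; split=> // t /repsP; right.
have [reps repsP] := choice H; exists reps => [|J t tJ]; last exact: (proj2 (repsP J)).
rewrite natr_sum -sumEFin /N_; apply: eq_bigr => J _; exact: (proj1 (repsP J)).
Qed.

Hypothesis Kflag : flag K.
Variable Pr : presentation (Cart G K).

Lemma card_rank_le_relations : card_rank_le (M_group G K) (rels Pr).
Proof.
have [L [S [k [Q [_ kR ktri QS]]]]] := module_presentation_exists Pr Kflag.
(* The diagonal coefficient of [k r] is nonzero, so [r] itself is a relator. *)
exists Q; rewrite (card_le_eql QS); apply: subset_card_le => r Sr.
by have [relR _] := kR r Sr; apply: relR; have [] := ktri r Sr.
Qed.

Lemma M_minus_le_relations : M_minus G K R <= counting (rels Pr).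
Proof.
have [Q QR] := card_rank_le_relations.
by apply: le_trans (counting_le R QR); apply: ereal_inf_lbound; exists Q.
Qed.

(** Infinitely many relations make the right side [+oo] for the dual addition. Otherwise the count
    of [gens_finite] applies, unless the left side is [-oo]. *)
Lemma deficiency_bound :
  (M_minus G K R - N_ G K R <= counting (rels Pr) - counting [set: gens Pr])%dE.
Proof.
have [relf|/(counting_infinite R)->] := pselect (finite_set (rels Pr)); last first.
  by rewrite DualAddTheoryNumDomain.daddye leey.
have [rs urs rsE] := finite_set_seq relf.
have relE : counting (rels Pr) = (size rs)%:R%:E :> \bar R by exact: counting_seq.
(* This excludes a left side [+oo - +oo], which would be [+oo] here. *)
have Mfin : M_minus G K R != +oo.
  by rewrite lt_eqF // (le_lt_trans M_minus_le_relations) // relE ltry.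
have [->|Nfin] := eqVneq (N_ G K R) +oo.
  by rewrite DualAddTheoryNumDomain.daddeNy // leNye.
have [reps repsN repsP] := tuple_covers Nfin.
have [l [l_lin l_inj]] := first_homology_functionals Pr repsP.
have [L [S [k [Q [[Ltot [Lanti Ltr]] kR ktri QS]]]]] := module_presentation_exists Pr Kflag.
have [xs [uxs xsE] xsb] := gens_finite Ltot Lanti Ltr (fun r Sr => proj1 (kR r Sr))
  (fun r Sr => proj2 (kR r Sr)) ktri l_lin l_inj urs rsE.
have Sf : finite_set S.
  apply: sub_finite_set relf => r Sr.
  by have [relR _] := kR r Sr; apply: relR; have [] := ktri r Sr.
have [ss uss ssE] := finite_set_seq Sf.
have Mss : M_minus G K R <= (size ss)%:R%:E.
  rewrite -(counting_seq R uss ssE); apply: le_trans (_ : counting [set: gens Q] <= _).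
    by apply: ereal_inf_lbound; exists Q.
  by apply: counting_le; rewrite (card_le_eql QS) card_lexx.
rewrite relE (counting_seq R uxs (A := [set: gens Pr])) => [|x]; last by split=> // _; exact: xsE.
rewrite -repsN; apply: le_trans (DualAddTheoryRealDomain.lee_dD2r _ Mss) _.
rewrite -DualAddTheoryNumDomain.dEFinB lee_fin lerBlDr addrAC lerBrDr -!natrD ler_nat.
by apply: xsb => // r /ssE.
Qed.

End Bounds.

Theorem theorem1p2 (R : realType) (m : nat) (K : scomplex m)
    (G : 'I_m -> groupType) :
  flag K ->
  (forall P : presentation (Cart G K),
     (M_minus G K R <= counting (rels P))%E
     /\ card_rank_le (M_group G K) (rels P))
  /\ (M_minus G K R - N_ G K R <= deficiency R (Cart G K))%dE.
Proof.
move=> Kflag; split=> [P|].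
  by split; [exact: M_minus_le_relations|exact: card_rank_le_relations].
by apply: le_ereal_inf_tmp => _ [P ->]; exact: deficiency_bound.
Qed.
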